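(* Let $k\ge3$ and consider a Poisson random hypergraph on $N$ vertices with parameters $(\beta_j)_{j\ge2}$ satisfying $\beta_j=1/(j(j-1))$ for $2\le j\le k-1$ and $\beta_k>1/(k(k-1))$. Let $z(t)=1-t-\exp(-\beta'(t))$, $t^*=\inf\{t\ge0:z(t)<0\}$, and assume $z$ has no zeros in $(0,t^* )$. Let $\delta>0$ be such that $\lim_{R\to\infty}\lim_{N\to\infty}\mathbb{P}(S_N^R\le N\delta)=0$, where $S_N^R=\inf\{i\ge N^{\alpha(k)}R^2:Z_N(i)\le0\}$. Let $\tilde Z_N$ be the modification of the breadth-first walk $Z_N$ in which no more patches are added after time $\lfloor N\delta\rfloor$: that is, $\tilde Z_N$ agrees with $Z_N$ up to the first time after $\lfloor N\delta\rfloor$ at which $Z_N$ goes below its past minimum $\min_{j\le \lfloor N\delta\rfloor}Z_N(j)$ (equivalently, the patch count $\tilde P_N(\lfloor Nt\rfloor)=P_N(\lfloor N\delta\rfloor)$ for all $t\ge\delta$), and from that time on $\tilde Z_N$ stays constant. Let $\tilde z(t)=z(t\wedge t^* )$. Then for all $\varepsilon>0$, $$\lim_{N\to\infty}\mathbb{P}\Big(\sup_{0\le t\le1}\Big|\tfrac1N\tilde Z_N(\lfloor Nt\rfloor)-\tilde z(t)\Big|>\varepsilon\Big)=0 .$$ Consequently, for any $0<\sigma<t^*$, $\sup_{0\le t\le\sigma}\big|\frac1NZ_N(\lfloor Nt\rfloor)-z(t)\big|\to0$ in probability.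
   Context: Poisson random hypergraph: vertex set $\{1,\dots,N\}$; $(\beta_j)_{j\ge2}$ nonnegative reals, $\beta(t)=\sum_{j\ge2}\beta_jt^j$ with $\beta'(1)<\infty$; for each $A$ with $|A|=j\ge2$, the number of hyperedges on $A$ is Poisson with mean $N\beta_j/\binom{N}{j}$, independently. A 1-edge is a patch; deleting a patched vertex $v$ removes it and replaces each other hyperedge containing $v$ by the hyperedge on its remaining vertices. Breadth-first walk: put a patch on the lowest-labelled vertex, call it $v(1)$. Having processed $v(1),\dots,v(i-1)$, the children of $v(i)$ are the not-yet-numbered vertices $w$ such that some original hyperedge consists of $v(i)$, $w$ and a subset of $\{v(1),\dots,v(i-1)\}$; they get the next numbers in order of original label, then $v(i)$ is deleted; if no numbered-but-undeleted vertex remains, a patch is placed on the lowest-labelled un-numbered vertex, which becomes the next numbered vertex. With $c(i)$ the number of children of $v(i)$: $Z_N(0)=0$, $Z_N(i)=Z_N(i-1)+c(i)-1$. The number of patches added before the $(i+1)$st deletion is $P_N(0)=1$, $P_N(i)=1-\min_{j\le i}Z_N(j)$. Also $\alpha(k)=(2k-4)/(2k-3)$. *)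

(* Defs.v *)
From HB Require Import structures.
From mathcomp Require Import all_boot all_order all_algebra.
From mathcomp Require Import all_classical all_reals all_analysis.

Set Implicit Arguments.
Unset Strict Implicit.
Unset Printing Implicit Defensive.

Import Order.TTheory GRing.Theory Num.Theory.
Local Open Scope ring_scope.
Local Open Scope classical_set_scope.

(* Poisson random hypergraph on the vertex set 'I_N (vertex i has label i).  *)
(* A configuration gives, for each subset A of the vertices, the number of   *)
(* hyperedges on A.                                                          *)
Definition config (N : nat) := {ffun {set 'I_N} -> nat}.

(* Poisson pmf with mean mu >= 0 (mean 0 is the Dirac mass at 0, as 0^0=1). *)
Definition pois_pmf {R : realType} (mu : R) (n : nat) : R :=
  mu ^+ n / (n`!)%:R * expR (- mu).

Definition hmean {R : realType} (beta : nat -> R) (N : nat) (A : {set 'I_N}) : R :=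
  if (2 <= #|A|)%N then N%:R * beta #|A| / ('C(N, #|A|))%:R else 0.

Definition hweight {R : realType} (beta : nat -> R) (N : nat) (c : config N) : R :=
  \prod_(A : {set 'I_N}) pois_pmf (hmean beta A) (c A).

Definition hprob {R : realType} (beta : nat -> R) (N : nat) (E : set (config N))
  : \bar R :=
  \esum_(c in E) (hweight beta c)%:E.

(* Breadth-first walk.  The state after i deletions is the sequence of       *)
(* numbered vertices v(1), v(2), ... (in numbering order).                   *)

(* if no numbered-but-undeleted vertex remains (i.e. fewer than i+1 numbered
   vertices), put a patch on the lowest-labelled un-numbered vertex, which
   becomes the next numbered vertex *)
Definition add_patch (N : nat) (ord : seq 'I_N) (i : nat) : seq 'I_N :=
  if (size ord <= i)%N then
    match [seq w <- enum 'I_N | w \notin ord] with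
    | w :: _ => rcons ord w
    | [::] => ord
    end
  else ord.

Definition children (N : nat) (c : config N) (proc ord : seq 'I_N) (v : 'I_N)
  : seq 'I_N :=
  [seq w <- enum 'I_N | (w \notin ord) &&
     [exists A : {set 'I_N}, [&& (0 < c A)%N, v \in A, w \in A &
        A \subset v |: (w |: [set x | x \in proc])]]].

Definition bfs_step (N : nat) (c : config N) (i : nat) (ord : seq 'I_N)
  : seq 'I_N * nat :=
  let ord1 := add_patch ord i in
  match drop i ord1 with
  | v :: _ => let ch := children c (take i ord1) ord1 v in (ord1 ++ ch, size ch)
  | [::] => (ord1, 0%N)
  end.

Fixpoint bfs_ord (N : nat) (c : config N) (i : nat) : seq 'I_N :=
  match i with
  | 0 => [::]
  | i'.+1 => (bfs_step c i' (bfs_ord c i')).1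
  end.

Definition nchild (N : nat) (c : config N) (i : nat) : nat :=
  (bfs_step c i.-1 (bfs_ord c i.-1)).2.

(* Z_N(0) = 0, Z_N(i) = Z_N(i-1) + c(i) - 1 *)
Definition Zwalk (N : nat) (c : config N) (i : nat) : int :=
  (\sum_(1 <= m < i.+1) (nchild c m)%:Z - i%:Z)%R.

Definition Zmin (N : nat) (c : config N) (n : nat) : int :=
  \big[Order.min/0%R]_(j < n.+1) Zwalk c j.

(* modified walk: no more patches after time n0 = floor(N delta).
   It agrees with Z_N up to (and including) the first time T >= n0 at which
   Z_N goes below min_{j<=n0} Z_N(j), and is constant (= Z_N(T)) afterwards. *)
Definition Ztilde (N : nat) (c : config N) (n0 i : nat) : int :=
  match [seq j <- iota n0 (i - n0).+1 | (Zwalk c j < Zmin c n0)%R] with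
  | j :: _ => Zwalk c j
  | [::] => Zwalk c i
  end.

Definition betaD {R : realType} (beta : nat -> R) (t : R) : R :=
  lim ((fun n : nat => \sum_(2 <= j < n) j%:R * beta j * t ^+ j.-1) @ \oo).

Definition zfl {R : realType} (beta : nat -> R) (t : R) : R :=
  1 - t - expR (- betaD beta t).

Definition tstar {R : realType} (beta : nat -> R) : R :=
  inf [set t : R | 0 <= t /\ zfl beta t < 0].

Definition ztilde {R : realType} (beta : nat -> R) (t : R) : R :=
  zfl beta (Order.min t (tstar beta)).

Definition alpha {R : realType} (k : nat) : R := (2 * k%:R - 4) / (2 * k%:R - 3).

Definition SNR {R : realType} (k N : nat) (c : config N) (r : R) : \bar R :=
  ereal_inf [set (i%:R)%:E | i in
    [set i : nat | (N%:R `^ alpha k * r ^+ 2 <= i%:R) /\ (Zwalk c i <= 0)%R]].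

(* Main.v *)
Require Import Defs.
From HB Require Import structures.
From mathcomp Require Import all_boot all_order all_algebra.
From mathcomp Require Import all_classical all_reals all_analysis.
From mathcomp Require Import ring lra zify.
Import Order.TTheory GRing.Theory Num.Theory.
Import numFieldNormedType.Exports.
Local Open Scope ring_scope.
Local Open Scope classical_set_scope.

(* Let U_i be the number of un-numbered vertices after i deletions. The next
   deletion inspects only hyperedges having two vertices outside the i deleted
   ones, and none of these was inspected before; hence, given the past, each
   un-numbered vertex stays un-numbered, independently, with a probability q_i, and Q_i = q_0 ... q_(i-1) = exp(-cumrate N i) by Pascal's rule. Patches
   apart, U_i - N Q_i is centred, and its second moment is at most N by
   induction on i, so Chebyshev's inequality on a finite mesh of times suffices
   for the law of large numbers: Z_N(i) + i is nondecreasing, which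
   interpolates between mesh times, and cumrate N (Nt) tends to beta'(t) by
   dominated convergence.
   The number of patches is at most 1 - min Z_N. On the event S_N^r > N delta
   it is O(N^alpha r^2) = o(N) until Z_N first goes below its minimum on
   [0, N delta]. That time cannot be before N t^* - o(N), as z > 0 on (0, t^* ),
   nor after N t^* + o(N), as z takes negative values arbitrarily close to the
   right of t^*. *)

Set Implicit Arguments.
Unset Strict Implicit.
Unset Printing Implicit Defensive.

(** * Products of Bernoulli laws and the law of the support *)

Lemma cvg_sumr (R : realType) (J : Type) (r : seq J) (P : pred J) (f : J -> nat -> R) (l : J -> R) :
  (forall j, P j -> f j n @[n --> \oo] --> l j) ->
  (fun n => \sum_(j <- r | P j) f j n) @ \oo --> \sum_(j <- r | P j) l j.
Proof.
move=> h; apply: (@cvg_big R _ +%R 0 P) => //; exact: add_continuous.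
Qed.

Lemma cvg_prodr (R : realType) (J : Type) (r : seq J) (P : pred J) (f : J -> nat -> R) (l : J -> R) :
  (forall j, P j -> f j n @[n --> \oo] --> l j) ->
  (fun n => \prod_(j <- r | P j) f j n) @ \oo --> \prod_(j <- r | P j) l j.
Proof.
move=> h; apply: (@cvg_big R _ *%R 1 P) => //; exact: mul_continuous.
Qed.

Section BernoulliProduct.
Context {R : realType} {I : finType}.
Implicit Types (e : I -> R) (f g : {ffun I -> bool} -> R) (b : {ffun I -> bool}).

(** Here [e i] is the probability that [b i] is false. In the application [i] is a set of vertices
    and [e i] the chance that it carries no hyperedge. *)
Definition bwt e b : R := \prod_i (if b i then 1 - e i else e i).

Definition bexp e f : R := \sum_b bwt e b * f b.

Definition flip (i : I) b : {ffun I -> bool} := [ffun j => (j == i) (+) b j].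

Lemma flipK i : involutive (flip i).
Proof. by move=> b; apply/ffunP => j; rewrite !ffunE addKb. Qed.

Lemma flip_off i b j : j != i -> flip i b j = b j.
Proof. by move=> /negPf ji; rewrite ffunE ji. Qed.

(** Pair each [b] having [b i] false with its flip at [i]: the two weights are [e i] and [1 - e i]
    times a common factor, and [f] does not tell the two apart. *)
Lemma bexp_absent1 e f i : (forall b, f (flip i b) = f b) ->
  bexp e (fun b => f b * (~~ b i)%:R) = bexp e f * e i.
Proof.
move=> fi; rewrite /bexp.
pose w b := \prod_(j | j != i) (if b j then 1 - e j else e j).
have bE b : bwt e b = (if b i then 1 - e i else e i) * w b.
  by rewrite /bwt (bigD1 i).
have wf b : w (flip i b) = w b.
  by apply: eq_bigr => j ji; rewrite flip_off.
rewrite (bigID (fun b => b i)) /= big1 ?add0r; last first.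
  by move=> b ->; rewrite !mulr0.
rewrite [X in _ = X * _](bigID (fun b => b i)) /=.
rewrite [X in (X + _) * _](reindex_inj (inv_inj (@flipK i))) /=.
rewrite [X in (X + _) * _](eq_bigl (fun b => ~~ b i)); last first.
  by move=> b; rewrite ffunE eqxx.
rewrite -big_split /= mulr_suml; apply: eq_bigr => b bi.
rewrite !bE wf fi ffunE eqxx /= (negPf bi) /=.
ring.
Qed.

(** Independence of disjoint sets of coordinates: [f] reads no coordinate of [s], so these split off
    one at a time. Since [s] has no repetition, the rest of the product does not read the coordinate
    being removed. *)
Lemma bexp_absent e f (s : seq I) : uniq s ->
  (forall b b', {in [predC s], b =1 b'} -> f b = f b') ->
  bexp e (fun b => f b * \prod_(i <- s) (~~ b i)%:R) = bexp e f * \prod_(i <- s) e i.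
Proof.
elim: s f => [|i s IH] f /=.
  move=> _ _; rewrite big_nil mulr1; apply: eq_bigr => b _.
  by rewrite big_nil mulr1.
move=> /andP[i_s us] fs; rewrite big_cons mulrCA mulrC -IH//; last first.
  by move=> b b' bb'; apply: fs => j; rewrite !inE negb_or => /andP[_ js]; apply: bb'.
rewrite -bexp_absent1.
  apply: eq_bigr => b _; rewrite big_cons.
  ring.
move=> b; congr (_ * _).
  by apply: fs => j; rewrite !inE negb_or => /andP[ji _]; rewrite flip_off.
rewrite !big_seq; apply: eq_bigr => j js; rewrite flip_off//.
by apply: contraNneq i_s => <-.
Qed.

Lemma bwt_ge0 e b : (forall i, 0 <= e i <= 1) -> 0 <= bwt e b.
Proof.
move=> e01; apply: prodr_ge0 => i _; have /andP[? ?] := e01 i.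
by case: ifP => // _; rewrite subr_ge0.
Qed.

Lemma bexp_le e f g : (forall i, 0 <= e i <= 1) ->
  (forall b, f b <= g b) -> bexp e f <= bexp e g.
Proof.
by move=> e01 fg; apply: ler_sum => b _; apply: ler_wpM2l => //; exact: bwt_ge0.
Qed.

Lemma bexpZ e f a : bexp e (fun b => a * f b) = a * bexp e f.
Proof. by rewrite /bexp mulr_sumr; apply: eq_bigr => b _; rewrite mulrCA. Qed.

Lemma bexpD e f g : bexp e (fun b => f b + g b) = bexp e f + bexp e g.
Proof. by rewrite /bexp -big_split; apply: eq_bigr => b _; rewrite mulrDr. Qed.

Lemma bexp_sum e (J : Type) (r : seq J) (P : pred J) (F : J -> {ffun I -> bool} -> R) :
  bexp e (fun b => \sum_(j <- r | P j) F j b) = \sum_(j <- r | P j) bexp e (F j).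
Proof.
by rewrite /bexp exchange_big /=; apply: eq_bigr => b _; rewrite mulr_sumr.
Qed.

Lemma bexp1 e : bexp e (fun=> 1) = 1.
Proof.
rewrite /bexp /bwt; under eq_bigr do rewrite mulr1.
rewrite -(bigA_distr_bigA (fun i (x : bool) => if x then 1 - e i else e i)).
by apply: big1 => i _; rewrite big_bool /= subrK.
Qed.

End BernoulliProduct.

(** * From Poisson multiplicities to Bernoulli supports *)

Section SupportLaw.
Context {R : realType}.

Definition supp (N : nat) (c : config N) : {ffun {set 'I_N} -> bool} :=
  [ffun A => (0 < c A)%N].

Definition unitcfg (N : nat) (b : {ffun {set 'I_N} -> bool}) : config N :=
  [ffun A => nat_of_bool (b A)].

Lemma pois_pmf_ge0 (mu : R) n : 0 <= mu -> 0 <= pois_pmf mu n.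
Proof.
move=> mu0; rewrite /pois_pmf mulr_ge0 ?expR_ge0// divr_ge0 ?exprn_ge0//.
Qed.

Lemma pois_pmf_sum (mu : R) (x : bool) :
  (fun M : nat => \sum_(i < M.+1 | (0 < i)%N == x) pois_pmf mu i) @ \oo -->
  (if x then 1 - expR (- mu) else expR (- mu)).
Proof.
have all1 : (fun M : nat => \sum_(i < M.+1) pois_pmf mu i) @ \oo --> (1 : R).
  rewrite -(expRxMexpNx_1 mu).
  have -> : (fun M : nat => \sum_(i < M.+1) pois_pmf mu i) =
    (fun M : nat => series (exp_coeff mu) M.+1 * expR (- mu)).
    apply/funext => M; rewrite /series /= big_mkord mulr_suml.
    by apply: eq_bigr.
  apply: cvgMr_tmp.
  by have := is_cvg_series_exp_coeff mu; rewrite -(cvg_shiftS (series (exp_coeff mu))).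
have off (M : nat) : \sum_(i < M.+1 | (0 < i)%N == false) pois_pmf mu i = expR (- mu).
  rewrite (big_pred1 ord0); last by move=> i /=; rewrite eqbF_neg -leqNgt leqn0.
  by rewrite /pois_pmf expr0 fact0 divr1 mul1r.
case: x; last first.
  by under eq_fun do rewrite off; exact: cvg_cst.
have -> : (fun M : nat => \sum_(i < M.+1 | (0 < i)%N == true) pois_pmf mu i) =
    (fun M : nat => \sum_(i < M.+1) pois_pmf mu i - expR (- mu)).
  apply/funext => M; rewrite -(off M) [in RHS](bigID (fun i : 'I_M.+1 => (0 < i)%N)) /=.
  rewrite [X in _ + X - _](eq_bigl (fun i : 'I_M.+1 => (0 < i)%N == false)) ?addrK; last first.
    by move=> i; rewrite eqbF_neg.
  by apply: eq_bigl => i; rewrite eqb_id.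
by apply: cvgB => //; exact: cvg_cst.
Qed.

Lemma hmean_ge0 (beta : nat -> R) N (A : {set 'I_N}) :
  (forall j : nat, (2 <= j)%N -> 0 <= beta j) -> 0 <= hmean beta A.
Proof.
move=> b0; rewrite /hmean; case: ifP => // A2.
by rewrite divr_ge0// mulr_ge0// b0.
Qed.

(** The supports of independent Poisson counts are independent Bernoulli variables, so an event that
    reads only the support has a finite expectation as its probability. The configurations of the
    event with all multiplicities at most [M] exhaust it as [M] grows, and their mass [S M]
    increases to that expectation. *)
Lemma hprobE (beta : nat -> R) N (E : set (config N)) :
  (forall j : nat, (2 <= j)%N -> 0 <= beta j) ->
  (forall c, E c <-> E (unitcfg (supp c))) ->
  hprob beta E =
  (bexp (fun A => expR (- hmean beta A)) (fun b => `[< E (unitcfg b) >]%:R))%:E.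
Proof.
move=> b0 Esupp; set e := fun A => _.
have w0 (c : config N) : 0 <= hweight beta c.
  by apply: prodr_ge0 => A _; apply: pois_pmf_ge0; exact: hmean_ge0.
pose toc (M : nat) (d : {ffun {set 'I_N} -> 'I_M.+1}) : config N :=
  [ffun A => nat_of_ord (d A)].
have toc_inj M : injective (@toc M).
  move=> d d' /ffunP dd'; apply/ffunP => A; apply: val_inj.
  by have := dd' A; rewrite !ffunE.
pose s M := map (@toc M) [seq d <- enum {: {ffun {set 'I_N} -> 'I_M.+1}} | `[< E (toc M d) >]].
have us M : uniq (s M) by rewrite (map_inj_uniq (@toc_inj M)) filter_uniq ?enum_uniq.
pose S M := \sum_(c <- s M) hweight beta c.
(* Group the configurations by support; distributivity turns the sum over those with support [b]
   into a product of one-dimensional sums. *)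
have SE M : S M = \sum_b `[< E (unitcfg b) >]%:R *
    \prod_A \sum_(i < M.+1 | (0 < i)%N == b A) pois_pmf (hmean beta A) i.
  rewrite /S /s big_map big_filter big_enum_cond /=.
  rewrite (partition_big (fun d => supp (toc M d)) predT)//=.
  apply: eq_bigr => b _; rewrite bigA_distr_big_dep /= mulr_sumr.
  rewrite big_mkcondl/=; apply: congr_big => //.
    move=> d; apply/eqP/familyP => [<- A|h].
      by rewrite unfold_in /= !ffunE.
    by apply/ffunP => A; have := h A; rewrite unfold_in /= !ffunE => /eqP.
  move=> d /eqP <-; rewrite (_ : E (toc M d) = E (unitcfg (supp (toc M d)))); last first.
    by apply/propext; exact: Esupp.
  case: asboolP => _; rewrite ?mul1r ?mul0r//.
  by apply: eq_bigr => A _; rewrite ffunE.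
have S_cvg : S @ \oo --> bexp e (fun b => `[< E (unitcfg b) >]%:R).
  rewrite (funext SE) /bexp.
  apply: cvg_sumr => b _; rewrite mulrC; apply: cvgMl_tmp.
  apply: cvg_prodr => A _.
  exact: pois_pmf_sum.
have S_le M : ((S M)%:E <= hprob beta E)%E.
  apply: esum_ge; exists [set` s M].
    split; first exact: finite_seq.
    by move=> c /= /mapP[d]; rewrite mem_filter => /andP[/asboolP Ed _] ->.
  by rewrite -fsbig_seq// sumEFin.
have S_nd : {homo S : n m / (n <= m)%N >-> n <= m}.
  move=> n m nm; rewrite !SE; apply: ler_sum => b _; apply: ler_wpM2l => //.
  apply: ler_prod => A _; apply/andP; split.
    by apply: sumr_ge0 => i _; apply: pois_pmf_ge0; exact: hmean_ge0.
  rewrite -!(big_mkord (fun i => (0 < i)%N == b A) (fun i => pois_pmf (hmean beta A) i)).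
  rewrite [leRHS](big_cat_nat _ (n := n.+1))//= lerDl.
  by apply: sumr_ge0 => i _; apply: pois_pmf_ge0; exact: hmean_ge0.
apply/eqP; rewrite eq_le; apply/andP; split; last first.
  rewrite -(cvg_lim _ S_cvg)//.
  have : (fun M => (S M)%:E) @ \oo --> (limn S)%:E.
    by apply: cvg_EFin; [exact: nearW|exact/(cvgP _ S_cvg)].
  move=> h; rewrite -(cvg_lim _ h)//; apply: lime_le; first exact/(cvgP _ h).
  exact: nearW.
apply: ge_ereal_sup => _ [X [finX XE] <-].
(* No multiplicity exceeds the total number of hyperedges, so the largest such total over the finite
   set [X] bounds a box containing [X]. *)
pose M := \max_(c <- finmap.enum_fset (fset_set X)) \sum_A c A.
have Xs : X `<=` [set` s M].
  move=> c Xc /=.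
  have cM A : (c A < M.+1)%N.
    rewrite ltnS; apply: (@leq_trans (\sum_A c A)%N).
      by rewrite (bigD1 A)//= leq_addr.
    have cX : c \in finmap.enum_fset (fset_set X).
      by have := in_fset_set finX c; rewrite mem_set.
    by rewrite /M (big_rem c cX) /= leq_maxl.
  apply/mapP; exists [ffun A => Ordinal (cM A)]; last first.
    by apply/ffunP => A; rewrite !ffunE.
  rewrite mem_filter mem_enum andbT; apply/asboolP.
  rewrite (_ : toc _ _ = c); first exact: XE.
  by apply/ffunP => A; rewrite !ffunE.
apply: (@le_trans _ _ (S M)%:E).
  rewrite /S -sumEFin [leRHS]fsbig_seq//; apply: lee_fsum_nneg_subset => //.
  - by move=> c; rewrite !inE; exact: Xs.
  - by move=> c _; rewrite lee_fin.
rewrite lee_fin -(cvg_lim _ S_cvg)//; apply: nondecreasing_cvgn_le => //.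
exact/(cvgP _ S_cvg).
Qed.

End SupportLaw.

(** * The breadth-first walk *)

Section Walk.
Context {N : nat}.
Implicit Types (c : config N) (s : seq 'I_N).

Definition patched c i : seq 'I_N := add_patch (bfs_ord c i) i.

Definition newpatch c i : nat := size (patched c i) - size (bfs_ord c i).

(** Counts the patches placed before the [i]-th deletion. A patch needed for deletion [i + 1] is not
    yet counted, although [patched c i] already contains it. *)
Definition npatch c i : nat := \sum_(m < i) newpatch c m.

Lemma add_patchP s i :
  (add_patch s i = s /\ ((i < size s)%N \/ forall w, w \in s)) \/
  (exists w, [/\ w \notin s, (size s <= i)%N & add_patch s i = rcons s w]).
Proof.
rewrite /add_patch; case: leqP => si; last by left; split => //; left.
case E : [seq w <- enum 'I_N | w \notin s] => [|w t].
  left; split => //; right => w; apply: contraT => ws.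
  have : w \in [seq w <- enum 'I_N | w \notin s] by rewrite mem_filter ws mem_enum.
  by rewrite E.
right; exists w; split => //.
have : w \in [seq w <- enum 'I_N | w \notin s] by rewrite E mem_head.
by rewrite mem_filter => /andP[].
Qed.

Lemma bfs_ordS c i : bfs_ord c i.+1 =
  if drop i (patched c i) is v :: _ then
    patched c i ++ children c (take i (patched c i)) (patched c i) v
  else patched c i.
Proof. by rewrite /= /bfs_step -/(patched c i); case: (drop i (patched c i)). Qed.

Lemma patched_prefix c i : exists t, patched c i = bfs_ord c i ++ t.
Proof.
rewrite /patched; case: (add_patchP (bfs_ord c i) i) => [[-> _]|[w [_ _ ->]]].
  by exists [::]; rewrite cats0.
by exists [:: w]; rewrite cats1.
Qed.

Lemma bfs_ordS_prefix c i : exists t, bfs_ord c i.+1 = patched c i ++ t.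
Proof.
rewrite bfs_ordS; case: (drop i (patched c i)) => [|v t].
  by exists [::]; rewrite cats0.
by eexists.
Qed.

Lemma bfs_ord_prefix c i j : (i <= j)%N -> exists t, bfs_ord c j = bfs_ord c i ++ t.
Proof.
elim: j => [|j IH]; first by rewrite leqn0 => /eqP ->; exists [::].
rewrite leq_eqVlt => /predU1P[->|/IH[t E]]; first by exists [::]; rewrite cats0.
have [u ->] := bfs_ordS_prefix c j; have [v ->] := patched_prefix c j.
by rewrite E; exists (t ++ v ++ u); rewrite !catA.
Qed.

Lemma bfs_ord_uniq c i : uniq (bfs_ord c i).
Proof.
elim: i => // i IH.
have up : uniq (patched c i).
  rewrite /patched; case: (add_patchP (bfs_ord c i) i) => [[-> _]//|[w [wi _ ->]]].
  by rewrite rcons_uniq wi.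
rewrite bfs_ordS; case: (drop i (patched c i)) => // v t.
rewrite cat_uniq up filter_uniq ?enum_uniq// andbT /=.
by apply/hasPn => w; rewrite mem_filter => /andP[/andP[]].
Qed.

Lemma patched_uniq c i : uniq (patched c i).
Proof.
have := bfs_ord_uniq c i.+1; have [t ->] := bfs_ordS_prefix c i.
by rewrite cat_uniq => /andP[].
Qed.

Lemma bfs_ord_size c i : (i <= size (bfs_ord c i))%N \/ forall w, w \in bfs_ord c i.
Proof.
elim: i => [|i IH]; first by left.
have [t ->] := bfs_ordS_prefix c i; rewrite /patched.
case: (add_patchP (bfs_ord c i) i) => [[-> [h|h]]|[w [wi si ->]]].
- by left; rewrite size_cat ltn_addr.
- by right => w; rewrite mem_cat h.
- case: IH => [h|h]; last by rewrite h in wi.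
  by left; rewrite size_cat size_rcons ltn_addr// ltnS.
Qed.

Lemma drop_patched_nil c i : drop i (patched c i) = [::] -> forall w, w \in patched c i.
Proof.
move/(congr1 size); rewrite size_drop /= => /eqP; rewrite subn_eq0 /patched.
case: (add_patchP (bfs_ord c i) i) => [[-> [h|h]//]|[w [wi si ->]]].
  by rewrite leqNgt h.
rewrite size_rcons; case: (bfs_ord_size c i) => [h|h]; last by rewrite h in wi.
by rewrite ltnNge h.
Qed.

Lemma take_patched c i : take i (patched c i) = take i (bfs_ord c i).
Proof.
rewrite /patched; case: (add_patchP (bfs_ord c i) i) => [[-> _]//|[w [wi si ->]]].
case: (bfs_ord_size c i) => [h|h]; last by rewrite h in wi.
by rewrite -cats1 takel_cat.
Qed.

(* The first i deletions only look at hyperedges with at most one vertex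
   outside the set of the deleted vertices. *)
Lemma bfs_ord_local c c' i :
  (forall A : {set 'I_N}, (#|A :\: [set x in take i (bfs_ord c i)]| <= 1)%N ->
     (0 < c A)%N = (0 < c' A)%N) ->
  forall m, (m <= i)%N -> bfs_ord c' m = bfs_ord c m.
Proof.
move=> cc'; elim=> // m IH mi.
have pE : patched c' m = patched c m by rewrite /patched IH// ltnW.
rewrite !bfs_ordS pE; case E : (drop m (patched c m)) => [|v t] //; congr (_ ++ _).
apply: eq_filter => w; congr (_ && _); apply: eq_existsb => A.
apply: andb_id2r => /and3P[vA wA Asub]; rewrite -cc'//.
have ms : (m < size (patched c m))%N.
  by rewrite ltnNge; apply/negP => /drop_oversize; rewrite E.
have [u Eu] := bfs_ord_prefix c mi; have [u' Eu'] := bfs_ordS_prefix c m.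
have takeE : take m.+1 (take i (bfs_ord c i)) = take m.+1 (patched c m).
  by rewrite take_takel// Eu Eu' -catA takel_cat.
(* Apart from [w], every vertex of [A] is [v] or was deleted before [v], hence is among the first
   [m + 1 <= i] numbered vertices. *)
rewrite -(cards1 w); apply: subset_leq_card; apply/fintype.subsetP => x.
rewrite !inE => /andP[xi /(fintype.subsetP Asub)]; rewrite !inE => /or3P[/eqP xv|//|xm].
- case/negP: xi; apply: (mem_take (n0 := m.+1)); rewrite takeE (take_nth x)//.
  have -> : nth x (patched c m) m = v.
    by rewrite -{1}(cat_take_drop m (patched c m)) nth_cat size_take ms ltnn subnn E.
  by rewrite xv mem_rcons mem_head.
- case/negP: xi; apply: (mem_take (n0 := m.+1)); rewrite takeE (take_nth x)//.
  by rewrite mem_rcons inE xm orbT.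
Qed.

Lemma bfs_ord_supp c i : bfs_ord (unitcfg (supp c)) i = bfs_ord c i.
Proof.
by apply: (@bfs_ord_local c _ i) => // A _; rewrite !ffunE; case: (c A).
Qed.

Lemma eq_npatch c c' i : (forall m, (m <= i)%N -> bfs_ord c' m = bfs_ord c m) ->
  npatch c' i = npatch c i.
Proof.
move=> h; apply: eq_bigr => m _.
by rewrite /newpatch /patched h// ltnW.
Qed.

Lemma newpatchE c i : size (patched c i) = (size (bfs_ord c i) + newpatch c i)%N.
Proof.
by rewrite /newpatch; have [t ->] := patched_prefix c i; rewrite size_cat addKn.
Qed.

Lemma nchildE c i : size (bfs_ord c i.+1) = (size (patched c i) + nchild c i.+1)%N.
Proof.
rewrite /nchild bfs_ordS /= /bfs_step -/(patched c i).
by case: (drop i (patched c i)) => [|v t] /=; rewrite ?addn0// size_cat.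
Qed.

Lemma Zwalk0 c : Zwalk c 0 = 0.
Proof. by rewrite /Zwalk big_geq// subr0. Qed.

Lemma ZwalkS c i : Zwalk c i.+1 = Zwalk c i + (nchild c i.+1)%:Z - 1.
Proof.
rewrite /Zwalk big_nat_recr//=; move: (\sum_(1 <= m < i.+1) _) => s; lia.
Qed.

Lemma npatchS c i : npatch c i.+1 = (npatch c i + newpatch c i)%N.
Proof. by rewrite /npatch big_ord_recr. Qed.

(** Every numbered vertex entered either as a patch or as a child, and [Zwalk c i + i] counts the
    children. *)
Lemma ZwalkE c i :
  Zwalk c i = (size (bfs_ord c i))%:Z - (npatch c i)%:Z - i%:Z.
Proof.
elim: i => [|i IH]; first by rewrite Zwalk0 /npatch big_ord0.
by rewrite ZwalkS IH nchildE newpatchE npatchS; lia.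
Qed.

Lemma Zwalk_supp c i : Zwalk (unitcfg (supp c)) i = Zwalk c i.
Proof.
rewrite !ZwalkE bfs_ord_supp (@eq_npatch c)// => m _; exact: bfs_ord_supp.
Qed.

Lemma Zwalk_drift c i j : (i <= j)%N -> Zwalk c i + i%:Z <= Zwalk c j + j%:Z.
Proof.
elim: j => [|j IH]; first by rewrite leqn0 => /eqP ->.
rewrite leq_eqVlt => /predU1P[->//|/IH]; rewrite ZwalkS; lia.
Qed.

Lemma Zwalk_ge c i : - i%:Z <= Zwalk c i.
Proof. by have := Zwalk_drift c (leq0n i); rewrite Zwalk0; lia. Qed.

(* A patch is only added when Z_N equals minus the number of patches so far. *)
Lemma npatch_le c i (kappa : nat) :
  (forall j, (j < i)%N -> - kappa%:Z <= Zwalk c j) -> (npatch c i <= kappa.+1)%N.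
Proof.
elim: i => [|i IH] h; first by rewrite /npatch big_ord0.
have {}IH : (npatch c i <= kappa.+1)%N by apply: IH => j ji; apply: h; exact: ltnW.
have := h i (ltnSn i); rewrite ZwalkE.
have := newpatchE c i.
rewrite npatchS /patched.
case: (add_patchP (bfs_ord c i) i) => [[-> _]|[w [_ si ->]]].
  by move=> E _; lia.
by rewrite size_rcons => E; lia.
Qed.

(** After time [i] the walk loses at most one per step, so up to time [j] it stays above
    [- (kappa + (j - i))]. *)
Lemma npatch_le_extend c i j (kappa : nat) : (i <= j)%N ->
  (forall l, (l <= i)%N -> - kappa%:Z <= Zwalk c l) ->
  (npatch c j <= (kappa + (j - i)).+1)%N.
Proof.
move=> ij low; apply: npatch_le => l lj; have [li|il] := leqP l i.
  have := low l li; lia.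
have := low i (leqnn i); have := Zwalk_drift c (ltnW il); lia.
Qed.

Lemma opprz_leS (kappa : nat) (z : int) : - kappa%:Z <= z -> - kappa.+1%:Z <= z.
Proof. lia. Qed.

Definition unnum c i : nat := #|[pred w | w \notin bfs_ord c i]|.

Lemma unnumE c i : (size (bfs_ord c i) + unnum c i = N)%N.
Proof.
rewrite -{3}(card_ord N) -(cardC (mem (bfs_ord c i))); congr (_ + _)%N.
by rewrite (card_uniqP _)// bfs_ord_uniq.
Qed.

(** The hyperedges that would make [w] a child of [v] when [P] is the set of deleted vertices. *)
Definition edges (v w : 'I_N) (P : {set 'I_N}) : {set {set 'I_N}} :=
  [set A : {set 'I_N} | [&& v \in A, w \in A & A \subset v |: (w |: P)]]%SET.

(** A vertex stays un-numbered exactly when no hyperedge of its family [edges] is present. The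
    indicator is written as a product of absence indicators, the form to which [bexp_absent]
    applies. *)
Lemma unnumS_cons c i v t : drop i (patched c i) = v :: t ->
  unnum c i.+1 = (\sum_(w | w \notin patched c i)
    \prod_(A <- enum (edges v w [set x in take i (patched c i)])) (c A == 0))%N.
Proof.
move=> E; rewrite /unnum -sum1_card.
rewrite big_mkcond [RHS]big_mkcond; apply: eq_bigr => w _.
rewrite inE bfs_ordS E mem_cat negb_or; case: (boolP (w \in patched c i)) => //= wp.
rewrite mem_filter mem_enum andbT wp /=.
set b := [exists A, _].
have -> : (\prod_(A <- enum (edges v w [set x in take i (patched c i)])) (c A == 0) = ~~ b)%N.
  case: (boolP b) => /existsP bP.
    have [A /and4P[cA vA wA Asub]] := bP.
    rewrite (bigD1_seq A) ?enum_uniq//=; last by rewrite mem_enum inE vA wA.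
    by rewrite eqn0Ngt cA.
  rewrite big_seq big1// => A; rewrite mem_enum inE => /and3P[vA wA Asub].
  rewrite eqn0Ngt; case: (posnP (c A)) => // cA; case: bP; exists A.
  by rewrite cA vA wA.
by case: (b).
Qed.

Lemma unnumS_nil c i : drop i (patched c i) = [::] -> unnum c i.+1 = 0%N.
Proof.
move=> E; apply: eq_card0 => w; rewrite inE bfs_ordS E.
by rewrite drop_patched_nil.
Qed.

End Walk.

(** * Second moment of the deviation *)

Section ConditionalVariance.
Context {R : realType} {I : finType}.
Implicit Types (e : I -> R) (f g : {ffun I -> bool} -> R) (b : {ffun I -> bool}).

Lemma eq_bexp e f g : f =1 g -> bexp e f = bexp e g.
Proof. by move=> fg; apply: eq_bigr => b _; rewrite fg. Qed.

(** Here [f] is to be the indicator of a past, and the [xi w] behave given [f] like pairwise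
    independent Bernoulli variables of mean [q]. Expanding the square, the cross terms cancel and
    each diagonal term contributes the variance [q - q ^+ 2]. *)
Lemma bexp_sqr_sum e f (J : finType) (W : pred J)
    (xi : J -> {ffun I -> bool} -> R) (q a : R) :
  (forall w, W w -> bexp e (fun b => f b * xi w b) = q * bexp e f) ->
  (forall w w', W w -> W w' -> bexp e (fun b => f b * (xi w b * xi w' b)) =
     (if w == w' then q else q ^+ 2) * bexp e f) ->
  bexp e (fun b => f b * (\sum_(w | W w) (xi w b - q) + a) ^+ 2) =
  (#|W|%:R * (q - q ^+ 2) + a ^+ 2) * bexp e f.
Proof.
move=> h1 h2.
pose C w w' b := f b * (xi w b * xi w' b) + (- q) * (f b * xi w b)
                 + (- q) * (f b * xi w' b) + q ^+ 2 * f b.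
pose D w b := 2 * a * (f b * xi w b) + (- (2 * a * q)) * f b.
transitivity (bexp e (fun b => \sum_(w | W w) (\sum_(w' | W w') C w w' b)
    + \sum_(w | W w) D w b + a ^+ 2 * f b)).
  apply: eq_bexp => b; set S := \sum_(w | W w) (xi w b - q).
  have -> : f b * (S + a) ^+ 2 = f b * (S * S) + 2 * a * f b * S + a ^+ 2 * f b by ring.
  congr (_ + _ + _).
    rewrite big_distrlr /= mulr_sumr; apply: eq_bigr => w _.
    by rewrite mulr_sumr; apply: eq_bigr => w' _; rewrite /C; ring.
  by rewrite mulr_sumr; apply: eq_bigr => w _; rewrite /D; ring.
rewrite 2!bexpD bexpZ 2!bexp_sum [X in _ + X + _]big1 => [|w Ww]; last first.
  by rewrite /D bexpD !bexpZ h1//; ring.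
rewrite addr0 mulrDl; congr (_ + _).
rewrite -sum1_card natr_sum !mulr_suml; apply: eq_bigr => w Ww.
rewrite bexp_sum (bigD1 w)//= big1 => [|w' /andP[Ww' w'w]].
  by rewrite /C !bexpD !bexpZ h2// h1// eqxx; ring.
by rewrite /C !bexpD !bexpZ h2// !h1// eq_sym (negPf w'w); ring.
Qed.

(** Law of total expectation over the fibres of [h]. Summing over representatives [b0] meets a fibre
    once per element, whence the division by its cardinality. *)
Lemma bexp_le_classes e (H : eqType) (h : {ffun I -> bool} -> H) f g :
  (forall b0, bexp e (fun b => (h b == h b0)%:R * f b) <=
              bexp e (fun b => (h b == h b0)%:R * g b)) ->
  bexp e f <= bexp e g.
Proof.
move=> fg; pose n b : R := #|[pred b' | h b' == h b]|%:R.
have n0 b : 0 < n b.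
  by rewrite ltr0n; apply/card_gt0P; exists b; rewrite inE.
have avg k : bexp e k = \sum_b0 (n b0)^-1 * bexp e (fun b => (h b == h b0)%:R * k b).
  under eq_bigr do rewrite -bexpZ.
  rewrite -bexp_sum; apply: eq_bexp => b.
  transitivity (\sum_(b0 | h b0 == h b) (n b)^-1 * k b).
    rewrite sumr_const -mulr_natr mulrAC mulVf ?mul1r//.
    by rewrite gt_eqF.
  rewrite big_mkcond /=; apply: eq_bigr => b0 _; rewrite eq_sym.
  case: eqP => [E|_]; rewrite ?mul0r ?mulr0// mul1r; congr (_^-1 * _).
  by rewrite /n; congr (_%:R); apply: eq_card => b'; rewrite !inE E.
rewrite !avg; apply: ler_sum => b0 _; apply: ler_wpM2l => //.
by rewrite invr_ge0 ltW.
Qed.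

End ConditionalVariance.

(** * Hyperedge rates and the variance recursion *)

Section Fluctuation.
Context {R : realType} (beta : nat -> R).
Hypothesis beta_ge0 : forall j : nat, (2 <= j)%N -> 0 <= beta j.

Definition cardmean N j : R := N%:R * beta j / 'C(N, j)%:R.

(** The mean number of hyperedges made of two given vertices and some of [i] deleted ones; [j] of
    them are deleted, so the size is [j + 2]. For [j + 2 > N] the binomial in [cardmean] is 0 and
    division by it gives 0. *)
Definition rate N i : R := \sum_(j < N) 'C(i, j)%:R * cardmean N j.+2.

(** The closed form, by Pascal's rule, of the sum of [rate N m] over [m < i]. *)
Definition cumrate N i : R := \sum_(j < N) 'C(i, j.+1)%:R * cardmean N j.+2.

Lemma cumrate0 N : cumrate N 0 = 0.
Proof. by apply: big1 => j _; rewrite bin0n mul0r. Qed.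

Lemma cumrateS N i : cumrate N i.+1 = cumrate N i + rate N i.
Proof.
by rewrite -big_split; apply: eq_bigr => j _; rewrite binS natrD mulrDl.
Qed.

Lemma rate_ge0 N i : 0 <= rate N i.
Proof.
by apply: sumr_ge0 => j _; rewrite mulr_ge0// divr_ge0// mulr_ge0// beta_ge0.
Qed.

(** Removing [v] and [w] is a bijection from [edges v w P] to the subsets of [P], which are then
    counted by cardinality. *)
Lemma sum_hmean_edges N (v w : 'I_N) (P : {set 'I_N}) :
  v != w -> v \notin P -> w \notin P ->
  \sum_(A in edges v w P) hmean beta A = rate N #|P|.
Proof.
move=> vw vP wP.
have cardvw (B : {set 'I_N}) : B \subset P -> #|v |: (w |: B)| = #|B|.+2.
  move=> BP; rewrite !cardsU1 !inE (negPf vw) /=.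
  have -> : v \notin B by apply: contraNN vP; exact: (fintype.subsetP BP).
  by have -> : w \notin B by apply: contraNN wP; exact: (fintype.subsetP BP).
transitivity (\sum_(B : {set 'I_N} | B \subset P) cardmean N #|B|.+2).
  rewrite (reindex_onto (fun B : {set 'I_N} => v |: (w |: B)) (fun A => A :\ v :\ w)) /=.
    apply: eq_big => [B|B /andP[]].
      rewrite inE !inE !eqxx orbT /=; apply/idP/idP => [/andP[/fintype.subsetP h /eqP E]|BP].
        apply/fintype.subsetP => x xB.
        have xin : x \in v |: (w |: B) by rewrite !inE xB !orbT.
        move: (xB); rewrite -E !inE => /and3P[xw xv _].
        by move: (h x xin); rewrite !inE (negPf xw) (negPf xv).
      apply/andP; split; first by rewrite !finset.setUS.
      apply/eqP/finset.setP => x; rewrite !inE.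
      have [->|xw] := eqVneq x w.
        by apply/esym/negbTE; apply: contraNN wP; exact: (fintype.subsetP BP).
      have [->|xv] //= := eqVneq x v.
      by apply/esym/negbTE; apply: contraNN vP; exact: (fintype.subsetP BP).
    rewrite inE !inE !eqxx orbT /= => /fintype.subsetP h /eqP E.
    have BP : B \subset P.
      apply/fintype.subsetP => x xB.
      have xin : x \in v |: (w |: B) by rewrite !inE xB !orbT.
      move: (xB); rewrite -E !inE => /and3P[xw xv _].
      by move: (h x xin); rewrite !inE (negPf xw) (negPf xv).
    by rewrite /hmean cardvw.
  move=> A; rewrite inE => /and3P[vA wA _]; apply/finset.setP => x; rewrite !inE.
  have [->|xv] := eqVneq x v; first by rewrite vA.
  by have [->|xw] := eqVneq x w; first by rewrite wA.
have cP (B : {set 'I_N}) : B \subset P -> (#|B| < N)%N.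
  move=> BP; rewrite -[X in (_ < X)%N](card_ord N).
  rewrite -cardsT; apply: proper_card; rewrite properE finset.subsetT /=.
  by apply/negP => /fintype.subsetP /(_ v (finset.in_setT v)) /(fintype.subsetP BP); rewrite (negPf vP).
rewrite /rate.
case: N v w P vw vP wP cardvw cP => [[]//|n] v w P vw vP wP _ cP.
rewrite (partition_big (fun B : {set 'I_n.+1} => inord #|B| : 'I_n.+1) predT)//=.
apply: eq_bigr => j _.
rewrite (eq_bigr (fun=> cardmean n.+1 j.+2)); last first.
  by move=> B /andP[BP /eqP <-]; rewrite inordK// cP.
rewrite sumr_const -[LHS]mulr_natl; congr (_%:R * _).
rewrite -cards_draws; apply: eq_card => B; rewrite [RHS]inE unfold_in.
case: (boolP (B \subset P)) => //= BP.
by apply/eqP/eqP => [<-|E]; [|apply: val_inj]; rewrite /= inordK// cP.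
Qed.

Section Deviation.
Variable N : nat.
Implicit Types c : config N.

(* The vertices lost to patches, each discounted by the later survival
   probabilities; adding them back to the un-numbered vertices makes the
   deviation below an exact multiple of a martingale. *)
Fixpoint carry c i : R :=
  if i is i'.+1 then expR (- rate N i') * (carry c i' + (newpatch c i')%:R) else 0.

Definition deviation c i : R :=
  (unnum c i)%:R + carry c i - N%:R * expR (- cumrate N i).

Lemma carry_bounds c i : 0 <= carry c i <= (npatch c i)%:R.
Proof.
elim: i => [|i /andP[IH0 IH1]] /=; first by rewrite lexx ler0n.
rewrite mulr_ge0 ?expR_ge0 ?addr_ge0//= npatchS natrD.
apply: (@le_trans _ _ (1 * (carry c i + (newpatch c i)%:R))).
  apply: ler_wpM2r; first by rewrite addr_ge0.
  by rewrite -expR0 ler_expR oppr_le0 rate_ge0.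
by rewrite mul1r lerD2r.
Qed.

Lemma eq_deviation c c' i : (forall m, (m <= i)%N -> bfs_ord c m = bfs_ord c' m) ->
  deviation c i = deviation c' i.
Proof.
move=> h; rewrite /deviation /unnum h//; congr (_ + _ - _).
elim: i h => //= i IH h; rewrite IH => [|m mi]; last by rewrite h// ltnW.
by rewrite /newpatch /patched h.
Qed.

(** Replacing the number of numbered vertices by [N] minus the un-numbered ones, the difference is
    exactly [- deviation + (carry - npatch)], and the bracket lies between [- npatch] and 0. *)
Lemma Zwalk_deviation c i :
  `|(Zwalk c i)%:~R - (N%:R - i%:R - N%:R * expR (- cumrate N i))| <=
  `|deviation c i| + (npatch c i)%:R.
Proof.
have -> : (Zwalk c i)%:~R - (N%:R - i%:R - N%:R * expR (- cumrate N i)) =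
    - deviation c i + (carry c i - (npatch c i)%:R).
  rewrite ZwalkE !rmorphB /= /deviation -!pmulrn.
  have -> : (size (bfs_ord c i))%:R = N%:R - (unnum c i)%:R :> R.
    by rewrite -[in N%:R](unnumE c i) natrD addrK.
  ring.
apply: le_trans (ler_normD _ _) _; rewrite normrN lerD2l.
have /andP[c0 c1] := carry_bounds c i.
by rewrite ler0_norm ?subr_le0// opprB gerBl.
Qed.

Let e (A : {set 'I_N}) : R := expR (- hmean beta A).

(** The classes of equal [history i] are the atoms of the information revealed by the first [i]
    deletions. *)
Definition history i (b : {ffun {set 'I_N} -> bool}) : seq (seq 'I_N) :=
  [seq bfs_ord (unitcfg b) m | m <- iota 0 i.+1].

Lemma historyP i b b' :
  reflect (forall m, (m <= i)%N -> bfs_ord (unitcfg b) m = bfs_ord (unitcfg b') m)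
          (history i b == history i b').
Proof.
apply: (iffP eqP) => [h m mi|h]; last first.
  by apply/eq_in_map => m; rewrite mem_iota => /andP[_]; rewrite add0n ltnS; exact: h.
by move/eq_in_map: h; apply; rewrite mem_iota /= add0n ltnS.
Qed.

(** The first [i] deletions have not inspected the hyperedges of [S], so altering those leaves the
    event of having the history of [b0] unchanged. *)
Lemma history_local i (b0 b b' : {ffun {set 'I_N} -> bool}) (S : seq {set 'I_N}) :
  (forall A, A \in S -> (1 < #|A :\: [set x in take i (bfs_ord (unitcfg b0) i)]|)%N) ->
  {in [predC S], b =1 b'} -> (history i b == history i b0) = (history i b' == history i b0).
Proof.
wlog suff aux : b b' / (forall A, A \in S ->
    (1 < #|A :\: [set x in take i (bfs_ord (unitcfg b0) i)]|)%N) ->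
  {in [predC S], b =1 b'} -> history i b == history i b0 -> history i b' == history i b0.
  move=> hS bb'; apply/idP/idP; apply: aux => //.
  by move=> A AS; rewrite bb'.
move=> hS bb' /eqP E; rewrite -E; apply/historyP.
have /historyP E' : history i b == history i b0 by rewrite E.
apply: (@bfs_ord_local _ (unitcfg b)) => A; rewrite E'// => hA; rewrite !ffunE bb'//.
by rewrite inE; apply/negP => /hS; rewrite ltnNge hA.
Qed.

(** On a class of equal history, the new deviation is the sum of the centred survival indicators
    [xi v w - q] plus [q] times the old deviation, which is constant there. The families
    [edges v w P] for distinct [w] are disjoint and uninspected, so [bexp_sqr_sum] applies, and
    [#|W| <= N]. *)
Lemma deviationS_le (b0 : {ffun {set 'I_N} -> bool}) i :
  bexp e (fun b => (history i b == history i b0)%:R * deviation (unitcfg b) i.+1 ^+ 2) <=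
  bexp e (fun b => (history i b == history i b0)%:R *
    (expR (- rate N i) ^+ 2 * deviation (unitcfg b) i ^+ 2
     + N%:R * (expR (- rate N i) - expR (- rate N i) ^+ 2))).
Proof.
set q := expR (- rate N i).
set c0 := unitcfg b0.
pose W := [pred w | w \notin patched c0 i].
pose P := [set x in take i (patched c0 i)]%SET.
pose xi v w (b : {ffun {set 'I_N} -> bool}) : R :=
  \prod_(A <- enum (edges v w P)) (~~ b A)%:R.
have q01 : 0 <= q <= 1.
  by rewrite expR_ge0 -expR0 ler_expR oppr_le0 rate_ge0.
have cardW : (#|W| + newpatch c0 i = unnum c0 i)%N.
  apply: (@addnI (size (bfs_ord c0 i))); rewrite unnumE addnCA addnC -newpatchE.
  rewrite -[RHS]card_ord -(cardC (mem (patched c0 i))); congr (_ + _)%N.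
  by rewrite (card_uniqP _)// patched_uniq.
have WN : #|W|%:R <= N%:R :> R.
  by rewrite ler_nat; have := max_card (mem W); rewrite card_ord.
(* The value [None] covers the case where all vertices are numbered and none is left to delete; then
   [W] is empty. *)
have [v [vW devE]] : exists v : option 'I_N,
    (if v is Some v then drop i (patched c0 i) = v :: behead (drop i (patched c0 i))
     else W =1 pred0) /\
    forall b, history i b == history i b0 -> deviation (unitcfg b) i.+1 =
      \sum_(w | W w) ((if v is Some v then xi v w b else 0) - q) + q * deviation c0 i.
  have hE b : history i b == history i b0 ->
      deviation (unitcfg b) i.+1 =
      (unnum (unitcfg b) i.+1)%:R - q * #|W|%:R + q * deviation c0 i.
    move=> /historyP h.
    have -> : deviation c0 i = deviation (unitcfg b) i by apply/esym/eq_deviation.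
    rewrite /deviation /= cumrateS opprD expRD -/q.
    have -> : newpatch (unitcfg b) i = newpatch c0 i by rewrite /newpatch /patched h.
    have -> : unnum (unitcfg b) i = unnum c0 i by rewrite /unnum h.
    by rewrite -cardW natrD; ring.
  case E : (drop i (patched c0 i)) => [|v t].
    have W0 : W =1 pred0 by move=> w; rewrite /= (drop_patched_nil E).
    exists None; split => // b hb; rewrite hE// big_pred0//.
    rewrite unnumS_nil ?eq_card0 ?mulr0 ?subr0//.
    by move/historyP : hb => hb; rewrite /patched hb.
  exists (Some v); split => // b hb; rewrite hE//; congr (_ + _).
  have bE : patched (unitcfg b) i = patched c0 i.
    by move/historyP : hb => hb; rewrite /patched hb.
  rewrite (@unnumS_cons _ _ _ v t) ?bE// sumrB sumr_const natr_sum; congr (_ - _).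
    apply: eq_bigr => w _; rewrite natr_prod; apply: eq_bigr => A _.
    by rewrite ffunE; case: (b A).
  by rewrite mulr_natr.
pose f b : R := (history i b == history i b0)%:R.
pose a := q * deviation c0 i.
have main : bexp e (fun b => f b *
    (\sum_(w | W w) ((if v is Some v then xi v w b else 0) - q) + a) ^+ 2) =
  (#|W|%:R * (q - q ^+ 2) + a ^+ 2) * bexp e f.
  case: v vW {devE} => [v|W0]; last first.
    by apply: bexp_sqr_sum => w; rewrite W0.
  set t := behead _ => vE.
  have vp : v \in patched c0 i by rewrite -(cat_take_drop i (patched c0 i)) vE mem_cat mem_head orbT.
  have := patched_uniq c0 i; rewrite -{1}(cat_take_drop i (patched c0 i)) cat_uniq.
  move=> /and3P[ut /hasPn dt _].
  have vP : v \notin P by rewrite inE; apply: dt; rewrite vE mem_head.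
  have wP w : W w -> v != w /\ w \notin P.
    move=> Ww; split; first by apply: contraNneq Ww => <-.
    by rewrite inE; apply: contraNN Ww; exact: mem_take.
  have si : (i < size (patched c0 i))%N.
    by rewrite ltnNge; apply/negP => /drop_oversize; rewrite vE.
  have cardP : #|P| = i.
    by rewrite cardsE (card_uniqP _)// size_take si.
  (* Such a hyperedge contains both [v] and [w], neither of them deleted, so the past has not
     inspected it. *)
  have edges2 w : W w -> forall A, A \in enum (edges v w P) ->
      (1 < #|A :\: [set x in take i (bfs_ord c0 i)]|)%N.
    move=> /wP[vw wnP] A; rewrite mem_enum inE -take_patched => /and3P[vA wA _].
    rewrite -[X in (X < _)%N]/(1%N) -(_ : #|[set v; w]%SET| = 2%N); last by rewrite cards2 vw.
    apply: subset_leq_card; apply/fintype.subsetP => x; rewrite !inE.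
    by move: vP wnP; rewrite !inE => vP wnP /orP[]/eqP ->; rewrite ?vP ?wnP.
  have prod_e w : W w -> \prod_(A <- enum (edges v w P)) e A = q.
    move=> /wP[vw wnP]; rewrite /e -expR_sum big_enum /= sumrN sum_hmean_edges//.
    by rewrite cardP.
  have xi2 w b : xi v w b * xi v w b = xi v w b.
    rewrite /xi -big_split /=; apply: eq_bigr => A _.
    by case: (b A) => /=; rewrite ?mulr0 ?mulr1.
  have first w : W w -> bexp e (fun b => f b * xi v w b) = q * bexp e f.
    move=> Ww; rewrite bexp_absent ?enum_uniq//; first by rewrite prod_e// mulrC.
    by move=> b b' bb'; rewrite /f (history_local (edges2 w Ww) bb').
  apply: bexp_sqr_sum => // w w' Ww Ww'.
  case: eqP => [<-|/eqP ww'].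
    by under eq_bexp do rewrite xi2; exact: first.
  rewrite (@eq_bexp _ _ _ _ (fun b => f b *
     \prod_(A <- enum (edges v w P) ++ enum (edges v w' P)) (~~ b A)%:R)); last first.
    by move=> b; rewrite big_cat.
  rewrite bexp_absent.
  - by rewrite big_cat /= !prod_e// mulrC.
  (* Disjointness: a member of [edges v w' P] that contains [w] would force [w] to be [v], [w'] or
     an element of [P]. *)
  - rewrite cat_uniq !enum_uniq andbT /=; apply/hasPn => A; rewrite !mem_enum !inE.
    move=> /and3P[_ w'A Asub]; apply/negP => /and3P[_ wA _].
    move: (fintype.subsetP Asub _ wA); rewrite !inE (negPf ww') /=.
    have [vw wnP] := wP w Ww; rewrite eq_sym (negPf vw) /=.
    by move: wnP; rewrite !inE => /negPf ->.
  - move=> b b' bb'; rewrite /f; congr ((_ : bool)%:R); apply: history_local bb' => A.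
    by rewrite mem_cat => /orP[]; apply: edges2.
rewrite (@eq_bexp _ _ _ _ (fun b => f b * (\sum_(w | W w)
   ((if v is Some v then xi v w b else 0) - q) + a) ^+ 2)); last first.
  move=> b; rewrite /f; case: eqP => [/eqP hb|]; last by rewrite !mul0r.
  by rewrite devE.
rewrite main -bexpZ; apply: bexp_le => [A|b].
  by rewrite /e expR_ge0 -expR0 ler_expR oppr_le0 hmean_ge0.
rewrite /f; case: eqP => [/eqP/historyP hb|]; last by rewrite mulr0 mul0r.
rewrite mulr1 mul1r (@eq_deviation (unitcfg b) c0)// addrC /a exprMn lerD2l.
apply: ler_wpM2r => //; rewrite subr_ge0 expr2.
by have /andP[q0 q1] := q01; rewrite ler_piMl.
Qed.

(** The one-step bound sends a second moment [x] to at most [q ^+ 2 * x + N * (q - q ^+ 2)]; for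
    [x <= N] this is at most [N * q <= N]. *)
Lemma deviation_sqr_le i :
  bexp e (fun b => deviation (unitcfg b) i ^+ 2) <= N%:R.
Proof.
elim: i => [|i IH].
  rewrite (@eq_bexp _ _ _ _ (fun=> 0)) ?/bexp ?big1// => b; rewrite ?mulr0//.
  rewrite /deviation /= cumrate0 oppr0 expR0 mulr1 addr0.
  have -> : unnum (unitcfg b) 0 = N by have := unnumE (unitcfg b) 0.
  by rewrite subrr expr0n.
set q := expR (- rate N i).
have /andP[q0 q1] : 0 <= q <= 1.
  by rewrite expR_ge0 -expR0 ler_expR oppr_le0 rate_ge0.
apply: le_trans (bexp_le_classes (h := history i) (fun b0 => deviationS_le b0 i)) _.
rewrite -/q bexpD bexpZ (@eq_bexp _ _ _ (fun=> N%:R * _) (fun=> N%:R * (q - q ^+ 2) * 1)); last first.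
  by move=> b; rewrite mulr1.
rewrite bexpZ bexp1 mulr1.
apply: (@le_trans _ _ (q ^+ 2 * N%:R + N%:R * (q - q ^+ 2))).
  by rewrite lerD2r ler_wpM2l// exprn_ge0.
by rewrite [X in X + _]mulrC -mulrDr addrC subrK ler_piMr.
Qed.

End Deviation.
End Fluctuation.

(** * Convergence of the survival rates *)

Section Estimates.
Context {R : realType}.
Implicit Types (s t a b : R).

Lemma dist_exprn_le s t n : 0 <= s <= 1 -> 0 <= t <= 1 ->
  `|s ^+ n - t ^+ n| <= n%:R * `|s - t|.
Proof.
move=> /andP[s0 s1] /andP[t0 t1]; elim: n => [|n IH]; first by rewrite subrr normr0 mul0r.
have -> : s ^+ n.+1 - t ^+ n.+1 = s * (s ^+ n - t ^+ n) + (s - t) * t ^+ n.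
  by rewrite !exprS; ring.
apply: le_trans (ler_normD _ _) _; rewrite !normrM -natr1 mulrDl mul1r lerD//.
  by apply: le_trans IH; rewrite ger0_norm// ler_piMl.
by rewrite ler_piMr// ger0_norm ?exprn_ge0// exprn_ile1.
Qed.

Lemma dist_small (x y z eta a : R) :
  `|x - y| <= a -> `|y| <= eta -> `|z| <= eta -> a <= eta -> `|x - z| <= 3 * eta.
Proof. by rewrite !ler_norml => /andP[? ?] /andP[? ?] /andP[? ?] ?; lra. Qed.

Lemma dist_expRN_le a b : 0 <= a -> 0 <= b ->
  `|expR (- a) - expR (- b)| <= `|a - b|.
Proof.
wlog ab : a b / a <= b.
  move=> h a0 b0; have [ab|/ltW ba] := leP a b; first exact: h.
  by rewrite distrC [leRHS]distrC h.
move=> a0 b0; rewrite [leRHS]distrC !ger0_norm ?subr_ge0//; last by rewrite ler_expR lerN2.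
have -> : expR (- a) - expR (- b) = expR (- a) * (1 - expR (- (b - a))).
  by rewrite mulrBr mulr1 -expRD; congr (_ - expR _); ring.
have h1 : 1 - expR (- (b - a)) <= b - a.
  by rewrite lerBlDr -lerBlDl; apply: le_trans (expR_ge1Dx _).
apply: le_trans h1; apply: ler_piMl.
  by rewrite subr_ge0 -expR0 ler_expR oppr_le0 subr_ge0.
by rewrite -expR0 ler_expR oppr_le0.
Qed.

Lemma powR_sublinear (p eta : R) : p < 1 -> 0 < eta ->
  \forall n \near \oo, n%:R `^ p <= eta * n%:R.
Proof.
move=> p1 eta0; have p0 : 0 < 1 - p by rewrite subr_gt0.
(* Beyond this threshold [n ^ (1 - p)] is at least [1 / eta]. *)
pose M := eta^-1 `^ (1 - p)^-1.
have M0 : 0 <= M by exact: powR_ge0.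
near=> n.
have n0 : 0 < n%:R :> R by rewrite ltr0n; near: n; exact: nbhs_infty_gt.
have Mn : M <= n%:R by near: n; exact: nbhs_infty_ger.
have -> : p = 1 - (1 - p) by ring.
rewrite powRB; last by rewrite (gt_eqF n0) implybT.
rewrite powRr1 ?(ltW n0)// mulrC ler_wpM2r ?(ltW n0)//.
rewrite -[leRHS]invrK lef_pV2 ?posrE ?invr_gt0 ?powR_gt0//.
apply: (@le_trans _ _ (M `^ (1 - p))).
  by rewrite /M -powRrM mulVf ?gt_eqF// powRr1// invr_ge0 (ltW eta0).
by apply: ge0_ler_powR => //; rewrite ?nnegrE ltW.
Unshelve. all: by end_near. Qed.

Lemma truncn_scale_cvg t : 0 <= t ->
  (Num.truncn (N%:R * t))%:R / N%:R @[N --> \oo] --> t.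
Proof.
move=> t0; apply/cvgrPdist_le => eps eps0; near=> N.
have N0 : 0 < N%:R :> R by rewrite ltr0n; near: N; exact: nbhs_infty_gt.
have /andP[h1 h2] := truncn_itv (mulr_ge0 (ltW N0) t0).
have NE : eps^-1 <= N%:R by near: N; exact: nbhs_infty_ger.
have NE' : 1 <= N%:R * eps.
  by rewrite -ler_pdivrMr// mul1r.
rewrite -(ler_pM2l N0) -{1}(ger0_norm (ltW N0)) -normrM mulrBr mulrCA divff ?gt_eqF// mulr1.
rewrite ger0_norm ?subr_ge0//.
rewrite lerBlDr; apply: le_trans (ltW h2) _.
by rewrite -natr1 addrC lerD2r.
Unshelve. all: by end_near. Qed.

Lemma subn_scale_cvg (u : nat -> nat) (l : R) j :
  (u N)%:R / N%:R @[N --> \oo] --> l -> (u N - j)%N%:R / N%:R @[N --> \oo] --> l.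
Proof.
move=> /cvgrPdist_le ul; apply/cvgrPdist_le => eps eps0.
have e20 : 0 < eps / 2 by rewrite divr_gt0.
move/(_ _ e20) : ul => ul; near=> N.
have N0 : 0 < N%:R :> R by rewrite ltr0n; near: N; exact: nbhs_infty_gt.
have jN : j%:R / (eps / 2) <= N%:R by near: N; exact: nbhs_infty_ger.
have {}jN : j%:R / N%:R <= eps / 2 by rewrite ler_pdivrMr// mulrC -ler_pdivrMr.
rewrite (splitr eps); apply: le_trans (ler_distD ((u N)%:R / N%:R) _ _) _.
apply: lerD; first by near: N.
apply: le_trans jN; rewrite -mulrBl normrM [X in _ * X]ger0_norm ?invr_ge0//.
rewrite ler_wpM2r ?invr_ge0//; have [ju|uj] := leqP j (u N).
  by rewrite natrB// opprB addrC subrK ger0_norm.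
have /eqP -> : (u N - j == 0)%N by rewrite subn_eq0 ltnW.
by rewrite subr0 ger0_norm// ler_nat ltnW.
Unshelve. all: by end_near. Qed.

(** Going from [j] to [j + 1] multiplies the ratio by [(floor (N t) - j) / (N - 1 - j)], which tends
    to [t]. *)
Lemma ratr_bin_cvg t j : 0 <= t ->
  'C(Num.truncn (N%:R * t), j)%:R / 'C(N.-1, j)%:R @[N --> \oo] --> t ^+ j.
Proof.
move=> t0; elim: j => [|j IH].
  by under eq_fun do rewrite !bin0 divr1; rewrite expr0; exact: cvg_cst.
have binS' n : ('C(n, j.+1))%:R = 'C(n, j)%:R * (n - j)%:R / j.+1%:R :> R.
  apply: (mulIf (x := j.+1%:R)); rewrite ?pnatr_eq0// divfK ?pnatr_eq0//.
  by rewrite -!natrM mulnC mul_bin_left mulnC.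
have -> : (fun N : nat => 'C(Num.truncn (N%:R * t), j.+1)%:R / 'C(N.-1, j.+1)%:R) =
    (fun N : nat => ('C(Num.truncn (N%:R * t), j)%:R / 'C(N.-1, j)%:R) *
      (((Num.truncn (N%:R * t) - j)%N%:R / N%:R) * ((N - j.+1)%N%:R / N%:R)^-1)) :> (nat -> R).
  apply/funext => N; rewrite !binS'.
  have [->|N0] := posnP N.
    by rewrite mulr0n mul0r truncn0 sub0n mulr0n !(mulr0, mul0r).
  have nN : N%:R != 0 :> R by rewrite pnatr_eq0 -lt0n.
  have -> : (N.-1 - j = N - j.+1)%N by lia.
  have frac (x a k y b n : R) : n != 0 -> k != 0 ->
      (x * a / k) / (y * b / k) = x / y * (a / n * (b / n)^-1).
    move=> n0 k0; rewrite !invfM !invrK; move: (y^-1) (b^-1) => y' b'.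
    by field; rewrite n0 k0.
  by rewrite (frac _ _ _ _ _ N%:R)// pnatr_eq0.
rewrite exprSr; apply: cvgM => //.
rewrite -[X in _ --> X]divr1; apply: cvgM; first exact/subn_scale_cvg/truncn_scale_cvg.
apply: cvgV; first exact: oner_neq0.
apply: subn_scale_cvg; apply: cvg_near_cst.
near=> N; rewrite divff// pnatr_eq0 -lt0n; near: N; exact: nbhs_infty_gt.
Unshelve. all: by end_near. Qed.

End Estimates.

(** * The derivative of the generating function as a uniform limit *)

Section GeneratingFunction.
Context {R : realType} (beta : nat -> R).
Hypothesis beta_ge0 : forall j : nat, (2 <= j)%N -> 0 <= beta j.
Hypothesis beta_cvg : cvg ((fun n : nat => \sum_(2 <= j < n) j%:R * beta j) @ \oo).

Definition betaDn (n : nat) (t : R) : R := \sum_(j < n) j.+2%:R * beta j.+2 * t ^+ j.+1.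

Let coef_ge0 j : 0 <= j.+2%:R * beta j.+2 :> R.
Proof. by rewrite mulr_ge0// beta_ge0. Qed.

Lemma betaDn_shift n t : \sum_(2 <= j < n.+2) j%:R * beta j * t ^+ j.-1 = betaDn n t.
Proof.
rewrite -(addn2 n) -{1}[2%N]add0n big_addn addnK big_mkord.
by apply: eq_bigr => j _; rewrite addn2.
Qed.

Lemma betaDn_nd t : 0 <= t -> {homo betaDn ^~ t : n m / (n <= m)%N >-> n <= m}.
Proof.
move=> t0 n m nm; rewrite /betaDn -!(big_mkord xpredT (fun j => j.+2%:R * beta j.+2 * t ^+ j.+1)).
rewrite [leRHS](big_cat_nat _ (n := n))//= lerDl.
by apply: sumr_ge0 => j _; rewrite mulr_ge0// exprn_ge0.
Qed.

(** Weierstrass comparison: on [0, 1] every tail is dominated by the tail at 1, which makes the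
    convergence uniform. *)
Lemma betaDn_tail t n m : 0 <= t <= 1 -> (n <= m)%N ->
  betaDn m t - betaDn n t <= betaDn m 1 - betaDn n 1.
Proof.
move=> /andP[t0 t1] nm; rewrite /betaDn.
rewrite -!(big_mkord xpredT (fun j => j.+2%:R * beta j.+2 * _ ^+ j.+1)).
rewrite !(@big_cat_nat _ _ _ n 0 m)//= ![_ + _ - _]addrAC !subrr !add0r.
by apply: ler_sum => j _; apply: ler_wpM2l => //; rewrite expr1n exprn_ile1.
Qed.

Lemma betaDn1_cvg : cvgn (betaDn ^~ 1).
Proof.
have /cvg_ex[l hl] := beta_cvg.
move: hl; rewrite -(cvg_shiftn 2) => hl; apply/cvg_ex; exists l.
rewrite (_ : betaDn ^~ 1 = [sequence \sum_(2 <= j < n + 2) j%:R * beta j]_n)//.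
apply/funext => n; rewrite /= addn2 -betaDn_shift; apply: eq_bigr => j _.
by rewrite expr1n mulr1.
Qed.

Lemma betaDn_cvg t : 0 <= t <= 1 -> betaDn n t @[n --> \oo] --> betaD beta t.
Proof.
move=> t01; have /andP[t0 t1] := t01.
have cv : cvgn (betaDn ^~ t).
  apply: nondecreasing_is_cvgn; first exact: betaDn_nd.
  exists (limn (betaDn ^~ 1)) => _ [n _ <-].
  apply: (@le_trans _ _ (betaDn n 1)).
    by apply: ler_sum => j _; apply: ler_wpM2l => //; rewrite expr1n exprn_ile1.
  by apply: nondecreasing_cvgn_le; [apply: betaDn_nd|exact: betaDn1_cvg].
suff <- : limn (betaDn ^~ t) = betaD beta t by [].
apply/esym/cvg_lim => //; rewrite -(cvg_shiftn 2).
rewrite (_ : [sequence _]_n = betaDn ^~ t)//.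
by apply/funext => n; rewrite /= addn2 betaDn_shift.
Qed.

Lemma betaDn_le t n : 0 <= t <= 1 -> betaDn n t <= betaD beta t.
Proof.
move=> t01; have h := betaDn_cvg t01; rewrite -(cvg_lim _ h)//.
apply: nondecreasing_cvgn_le; last exact/(cvgP _ h).
by apply: betaDn_nd; case/andP: t01.
Qed.

Lemma betaD_ge0 t : 0 <= t <= 1 -> 0 <= betaD beta t.
Proof. by move=> t01; have := betaDn_le 0 t01; rewrite /betaDn big_ord0. Qed.

Lemma betaD_tail t n : 0 <= t <= 1 ->
  betaD beta t - betaDn n t <= betaD beta 1 - betaDn n 1.
Proof.
move=> t01; have t11 : 0 <= (1 : R) <= 1 by rewrite ler01 lexx.
rewrite lerBlDr; have h := betaDn_cvg t01; rewrite -(cvg_lim _ h)//.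
apply: limr_le; first exact/(cvgP _ h).
near=> m; rewrite -lerBlDr; have nm : (n <= m)%N by near: m; exact: nbhs_infty_ge.
by apply: le_trans (betaDn_tail t01 nm) _; rewrite lerD2r betaDn_le.
Unshelve. all: by end_near. Qed.

Lemma betaD_approx eps : 0 < eps -> exists n, betaD beta 1 - betaDn n 1 <= eps.
Proof.
move=> eps0; have t11 : 0 <= (1 : R) <= 1 by rewrite ler01 lexx.
have /cvgrPdist_le /(_ _ eps0) [n _ /(_ n (leqnn n)) /= hn] := betaDn_cvg t11.
by exists n; apply: le_trans hn; rewrite ler_norm.
Qed.

(** A partial sum uniformly within [eps / 3] of the limit is a polynomial with Lipschitz constant
    [C] on [0, 1]. Dividing by [C + 1] allows [C = 0]. *)
Lemma betaD_unif_continuous eps : 0 < eps -> exists2 rho, 0 < rho &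
  forall s t, 0 <= s <= 1 -> 0 <= t <= 1 -> `|s - t| <= rho ->
    `|betaD beta s - betaD beta t| <= eps.
Proof.
move=> eps0; have e3 : 0 < eps / 3 by rewrite divr_gt0.
have [n hn] := betaD_approx e3.
pose C := \sum_(j < n) (j.+2%:R * beta j.+2) * j.+1%:R.
have C0 : 0 <= C by apply: sumr_ge0 => j _; rewrite mulr_ge0.
exists (eps / 3 / (C + 1)); first by rewrite divr_gt0// ltr_wpDl.
move=> s t s01 t01 st.
have tailb u : 0 <= u <= 1 -> `|betaD beta u - betaDn n u| <= eps / 3.
  move=> u01; rewrite ger0_norm ?subr_ge0 ?betaDn_le//.
  exact: le_trans (betaD_tail n u01) hn.
have mid : `|betaDn n s - betaDn n t| <= eps / 3.
  apply: (@le_trans _ _ (C * `|s - t|)).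
    rewrite /betaDn -sumrB mulr_suml; apply: le_trans (ler_norm_sum _ _ _) _.
    apply: ler_sum => j _; rewrite -mulrBr normrM ger0_norm// -mulrA ler_wpM2l//.
    exact: dist_exprn_le.
  apply: (@le_trans _ _ ((C + 1) * (eps / 3 / (C + 1)))).
    by apply: ler_pM => //; rewrite lerDl.
  by rewrite mulrC divfK// gt_eqF// ltr_wpDl.
have -> : betaD beta s - betaD beta t = (betaD beta s - betaDn n s)
   + (betaDn n s - betaDn n t) - (betaD beta t - betaDn n t) by ring.
apply: le_trans (ler_normB _ _) _; have -> : eps = eps / 3 + eps / 3 + eps / 3 by field.
by apply: lerD; [apply: le_trans (ler_normD _ _) _; apply: lerD|]; auto.
Qed.

(** By [N * 'C(N.-1, m) = m.+1 * 'C(N, m.+1)]; both binomials vanish together. This turns [cumrate]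
    into the series of [betaD] with powers of [t] replaced by ratios of binomials. *)
Lemma cardmeanE N m : (0 < N)%N ->
  cardmean beta N m.+1 = m.+1%:R * beta m.+1 / 'C(N.-1, m)%:R.
Proof.
move=> N0; have nN : N%:R != 0 :> R by rewrite pnatr_eq0 -lt0n.
have D : N%:R * 'C(N.-1, m)%:R = m.+1%:R * 'C(N, m.+1)%:R :> R.
  by rewrite -!natrM mul_bin_diag.
rewrite /cardmean; have [x0|x0] := eqVneq ('C(N, m.+1)%:R : R) 0.
  move/eqP: D; rewrite x0 mulr0 mulf_eq0 (negPf nN) /= => /eqP ->.
  by rewrite invr0 !mulr0.
have y0 : 'C(N.-1, m)%:R != 0 :> R.
  apply: contra_neq x0 => y0; move/eqP: D.
  by rewrite y0 mulr0 eq_sym mulf_eq0 pnatr_eq0 => /eqP.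
have -> : N%:R = m.+1%:R * 'C(N, m.+1)%:R / 'C(N.-1, m)%:R :> R by rewrite -D mulfK.
by field; rewrite x0 y0.
Qed.

(** Dominated convergence: each ratio [r N j] tends to [t ^+ j] and lies in [0, 1], so the tails are
    bounded by those of the convergent series at 1. *)
Lemma cumrate_cvg t : 0 <= t < 1 ->
  cumrate beta N (Num.truncn (N%:R * t)) @[N --> \oo] --> betaD beta t.
Proof.
move=> /andP[t0 t1]; have t01 : 0 <= t <= 1 by rewrite t0 ltW.
pose r N j : R := 'C(Num.truncn (N%:R * t), j)%:R / 'C(N.-1, j)%:R.
have cE N : cumrate beta N (Num.truncn (N%:R * t)) =
    \sum_(j < N) j.+2%:R * beta j.+2 * r N j.+1.
  apply: eq_bigr => j _; rewrite cardmeanE; last exact: leq_ltn_trans (ltn_ord j).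
  by rewrite mulrCA.
apply/cvgrPdist_le => eps eps0; have e3 : 0 < eps / 3 by rewrite divr_gt0.
have [n hn] := betaD_approx e3.
have fin : \sum_(j < n) j.+2%:R * beta j.+2 * r N j.+1 @[N --> \oo] --> betaDn n t.
  by apply: cvg_sumr => j _; apply: cvgM; [exact: cvg_cst|exact: ratr_bin_cvg].
move/cvgrPdist_le : fin => /(_ _ e3) fin.
near=> N; rewrite cE.
have N0 : (0 < N)%N by near: N; exact: nbhs_infty_gt.
have nN : (n <= N)%N by near: N; exact: nbhs_infty_ge.
have finN : `|betaDn n t - \sum_(j < n) j.+2%:R * beta j.+2 * r N j.+1| <= eps / 3 by near: N.
(* The strict bound [t < 1] puts the time at most [N - 1], so that the ratios of binomials do not
   exceed 1. *)
have iN : (Num.truncn (N%:R * t) <= N.-1)%N.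
  rewrite -ltnS prednK// truncn_lt_nat ?mulr_ge0// gtr_pMr// ltr0n//.
have r01 j : 0 <= r N j <= 1.
  rewrite /r divr_ge0//=; have [->|Cj] := posnP 'C(N.-1, j).
    by rewrite mulr0n invr0 mulr0 ler01.
  by rewrite ler_pdivrMr ?ltr0n// mul1r ler_nat leq_bin2l.
have -> : \sum_(j < N) j.+2%:R * beta j.+2 * r N j.+1 =
  \sum_(j < n) j.+2%:R * beta j.+2 * r N j.+1 + \sum_(n <= j < N) j.+2%:R * beta j.+2 * r N j.+1.
  rewrite -!(big_mkord xpredT (fun j => j.+2%:R * beta j.+2 * r N j.+1)).
  by rewrite -big_cat_nat.
set A := \sum_(j < n) _ in finN *; set B := \sum_(n <= j < N) _.
have B0 : 0 <= B.
  by apply: sumr_ge0 => j _; have /andP[? _] := r01 j.+1; rewrite mulr_ge0.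
have B1 : B <= eps / 3.
  have t11 : 0 <= (1 : R) <= 1 by rewrite ler01 lexx.
  apply: (@le_trans _ _ (betaDn N 1 - betaDn n 1)).
    rewrite /betaDn -!(big_mkord xpredT (fun j => j.+2%:R * beta j.+2 * 1 ^+ j.+1)).
    rewrite (@big_cat_nat _ _ _ n 0 N)//= [_ + _ - _]addrAC subrr add0r.
    apply: ler_sum => j _; apply: ler_wpM2l => //; rewrite expr1n.
    by have /andP[] := r01 j.+1.
  by apply: le_trans hn; rewrite lerD2r betaDn_le.
have -> : betaD beta t - (A + B) = (betaD beta t - betaDn n t) + (betaDn n t - A) - B by ring.
apply: le_trans (ler_normB _ _) _; have -> : eps = eps / 3 + eps / 3 + eps / 3 by field.
apply: lerD; last by rewrite ger0_norm.
apply: le_trans (ler_normD _ _) _; apply: lerD => //.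
rewrite ger0_norm ?subr_ge0 ?betaDn_le//.
exact: le_trans (betaD_tail n t01) hn.
Unshelve. all: by end_near. Qed.

End GeneratingFunction.

(** * The modified walk and the limit function *)

Section ModifiedWalk.
Context {N : nat}.
Implicit Types c : config N.

(** Either the modified walk has not been frozen by time [n], or it was frozen at the first
    undershoot [T]. Steps are at least -1, so an undershoot costs only one unit more than
    [kappa]. *)
Lemma Ztilde_dichotomy c n0 n (kappa : nat) :
  (forall j, (j <= n0)%N -> - kappa%:Z <= Zwalk c j) ->
  ((forall j, (j <= n)%N -> - kappa%:Z <= Zwalk c j) /\ Ztilde c n0 n = Zwalk c n) \/
  (exists T, [/\ (n0 < T <= n)%N, (forall j, (j <= T)%N -> - kappa.+1%:Z <= Zwalk c j),
     Zwalk c T <= 0 & Ztilde c n0 n = Zwalk c T]).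
Proof.
move=> low.
have minle j : (j <= n0)%N -> Zmin c n0 <= Zwalk c j.
  move=> jn; exact: (@bigmin_le _ _ _ _ (Ordinal (jn : (j < n0.+1)%N)) (fun j : 'I_n0.+1 => Zwalk c j)).
have minlow : - kappa%:Z <= Zmin c n0.
  apply: le_bigmin; first by rewrite oppr_le0.
  by move=> j _; apply: low; rewrite -ltnS.
have min0 : Zmin c n0 <= 0 by exact: bigmin_le_id.
have after j : (n0 <= j <= n)%N ->
    j \notin [seq j <- iota n0 (n - n0).+1 | (Zwalk c j < Zmin c n0)%R] ->
    - kappa%:Z <= Zwalk c j.
  move=> /andP[n0j jn]; rewrite mem_filter mem_iota n0j /=.
  have -> : (j < n0 + (n - n0).+1)%N by lia.
  by rewrite andbT -leNgt; exact: le_trans.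
rewrite /Ztilde; case E : [seq j <- iota _ _ | _] => [|T s].
  left; split => // j jn; have [jn0|n0j] := leqP j n0; first exact: low.
  by apply: after; rewrite ?E// (ltnW n0j).
right; exists T.
have : T \in [seq j <- iota n0 (n - n0).+1 | (Zwalk c j < Zmin c n0)%R] by rewrite E mem_head.
rewrite mem_filter mem_iota => /andP[ZT /andP[n0T Tn]].
(* The search in [Ztilde] starts at [n0], but the walk at [n0] is not below a minimum that includes
   it. *)
have n0T' : (n0 < T)%N.
  rewrite ltn_neqAle n0T andbT; apply: contraTneq ZT => <-.
  by rewrite -leNgt minle.
have Tn' : (T <= n)%N by lia.
have before j : (j < T)%N -> - kappa%:Z <= Zwalk c j.
  move=> jT; have [jn0|n0j] := leqP j n0; first exact: low.
  apply: after; first by rewrite (ltnW n0j) (leq_trans (ltnW jT)).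
  (* The filtered list is increasing, so its head is the first undershoot. *)
  have : sorted ltn (T :: s) by rewrite -E sorted_filter//; [exact: ltn_trans|exact: iota_ltn_sorted].
  rewrite E inE negb_or /= => /(order_path_min ltn_trans)/allP sT.
  by rewrite ltn_eqF//=; apply/negP => /sT; rewrite ltnNge ltnW.
split => //; first by rewrite n0T'.
- move=> j; rewrite leq_eqVlt => /predU1P[->|/before]; last lia.
  have T1 : (T.-1 < T)%N by lia.
  have := before _ T1; have := Zwalk_drift c (ltnW T1); lia.
- exact: le_trans (ltW ZT) _.
Qed.

End ModifiedWalk.

(** * Shape of the limit function around [tstar] *)

Section FluidLimit.
Context {R : realType} (beta : nat -> R).
Hypothesis beta_ge0 : forall j : nat, (2 <= j)%N -> 0 <= beta j.
Hypothesis beta_cvg : cvg ((fun n : nat => \sum_(2 <= j < n) j%:R * beta j) @ \oo).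

Let t00 : 0 <= (0 : R) <= 1. Proof. by rewrite lexx ler01. Qed.
Let t11 : 0 <= (1 : R) <= 1. Proof. by rewrite ler01 lexx. Qed.

Lemma zfl0 : zfl beta 0 = 0.
Proof.
have h := betaDn_cvg beta_ge0 beta_cvg t00.
have : betaD beta 0 = 0.
  rewrite -(cvg_lim _ h)//; apply: lim_near_cst => //; apply: nearW => n.
  by apply: big1 => j _; rewrite expr0n mulr0.
by rewrite /zfl => ->; rewrite oppr0 expR0 addr0 subrr.
Qed.

Lemma zfl1_lt0 : zfl beta 1 < 0.
Proof. by rewrite /zfl subrr sub0r oppr_lt0 expR_gt0. Qed.

Lemma expRN_betaD_unif_continuous eps : 0 < eps -> exists2 rho, 0 < rho &
  forall s t, 0 <= s <= 1 -> 0 <= t <= 1 -> `|s - t| <= rho ->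
    `|expR (- betaD beta s) - expR (- betaD beta t)| <= eps.
Proof.
move=> /(betaD_unif_continuous beta_ge0 beta_cvg) [rho rho0 h]; exists rho => // s t s01 t01 st.
apply: le_trans (h s t s01 t01 st); apply: dist_expRN_le; exact: betaD_ge0.
Qed.

Lemma zfl_unif_continuous eps : 0 < eps -> exists2 rho, 0 < rho &
  forall s t, 0 <= s <= 1 -> 0 <= t <= 1 -> `|s - t| <= rho ->
    `|zfl beta s - zfl beta t| <= eps.
Proof.
move=> eps0; have e2 : 0 < eps / 2 by rewrite divr_gt0.
have [rho rho0 h] := expRN_betaD_unif_continuous e2.
exists (Num.min rho (eps / 2)); first by rewrite lt_min rho0.
move=> s t s01 t01; rewrite le_min => /andP[st1 st2].
have := h s t s01 t01 st1; rewrite /zfl => hst.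
have -> : 1 - s - expR (- betaD beta s) - (1 - t - expR (- betaD beta t)) =
  - (s - t) - (expR (- betaD beta s) - expR (- betaD beta t)) by ring.
rewrite (splitr eps); apply: le_trans (ler_normB _ _) _.
by rewrite normrN lerD.
Qed.

Let S := [set t : R | 0 <= t /\ zfl beta t < 0].

Let S1 : S 1. Proof. by split; [exact: ler01|exact: zfl1_lt0]. Qed.

Let S_lb : lbound S 0. Proof. by move=> t []. Qed.

Let S_hinf : has_inf S. Proof. by split; [exists 1|exists 0]. Qed.

Lemma tstar_ge0 : 0 <= tstar beta.
Proof. by apply: lb_le_inf => //; exists 1. Qed.

Lemma tstar_le t : 0 <= t -> zfl beta t < 0 -> tstar beta <= t.
Proof. by move=> t0 zt; apply: ge_inf; [exists 0|split]. Qed.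

(** By continuity [zfl] is still negative slightly to the left of 1. The strict inequality leaves
    room for mesh times beyond [tstar] at which [cumrate_cvg] applies. *)
Lemma tstar_lt1 : tstar beta < 1.
Proof.
have e0 : 0 < - zfl beta 1 / 2 by rewrite divr_gt0// oppr_gt0 zfl1_lt0.
have [rho rho0 h] := zfl_unif_continuous e0.
pose t := 1 - Num.min rho 1.
have t1 : t < 1 by rewrite gtrBl lt_min rho0 ltr01.
have t0 : 0 <= t by rewrite subr_ge0 ge_min lexx orbT.
have t01 : 0 <= t <= 1 by rewrite t0 ltW.
apply: le_lt_trans t1; apply: tstar_le => //.
have := h t 1 t01 t11.
have -> : t - 1 = - Num.min rho 1 by rewrite /t; ring.
rewrite normrN ger0_norm; last by rewrite le_min ltW// ler01.
rewrite ge_min lexx => /(_ isT); rewrite ler_norml => /andP[_]; have := zfl1_lt0; lra.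
Qed.

Lemma tstar_adherent rho : 0 < rho -> exists u,
  [/\ tstar beta <= u, u < tstar beta + rho, u < 1 & zfl beta u < 0].
Proof.
move=> rho0; have r0 : 0 < Num.min rho (1 - tstar beta).
  by rewrite lt_min rho0 subr_gt0 tstar_lt1.
have [u [u0 zu] hu] := inf_adherent r0 S_hinf.
have {}hu : u < tstar beta + Num.min rho (1 - tstar beta) by exact: hu.
exists u; split => //; first exact: tstar_le.
- by apply: lt_le_trans hu _; rewrite lerD2l ge_min lexx.
- by apply: lt_le_trans hu _; rewrite addrC -lerBrDr ge_min lexx orbT.
Qed.

(** A negative value would persist to the left of [tstar], which is positive as [zfl] vanishes at 0,
    against the infimum. A positive value would persist to the right, against the negative values
    found there. *)
Lemma zfl_tstar : zfl beta (tstar beta) = 0.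
Proof.
have ts01 : 0 <= tstar beta <= 1 by rewrite tstar_ge0 ltW// tstar_lt1.
have [zn|zp|//] := ltrgtP (zfl beta (tstar beta)) 0.
- have e0 : 0 < - zfl beta (tstar beta) / 2 by rewrite divr_gt0// oppr_gt0.
  have [rho rho0 h] := zfl_unif_continuous e0.
  have tp : 0 < tstar beta.
    by rewrite lt_neqAle tstar_ge0 andbT; apply: contraTneq zn => <-; rewrite zfl0 ltxx.
  pose s := tstar beta - Num.min rho (tstar beta).
  have m0 : 0 < Num.min rho (tstar beta) by rewrite lt_min rho0.
  have s0 : 0 <= s by rewrite subr_ge0 ge_min lexx orbT.
  have sl : s < tstar beta by rewrite gtrBl.
  have : zfl beta s < 0.
    have s01 : 0 <= s <= 1 by rewrite s0 (le_trans (ltW sl))//; case/andP: ts01.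
    have := h s (tstar beta) s01 ts01.
    have -> : s - tstar beta = - Num.min rho (tstar beta) by rewrite /s; ring.
    rewrite normrN gtr0_norm// ge_min lexx => /(_ isT).
    by rewrite ler_norml => /andP[_]; lra.
  by move=> /(tstar_le s0); rewrite leNgt sl.
- have e0 : 0 < zfl beta (tstar beta) / 2 by rewrite divr_gt0.
  have [rho rho0 h] := zfl_unif_continuous e0.
  have [u [tu ut u1 zu]] := tstar_adherent rho0.
  have u01 : 0 <= u <= 1 by rewrite (le_trans tstar_ge0 tu) ltW.
  have := h _ _ u01 ts01; rewrite ger0_norm ?subr_ge0// lerBlDl ltW// => /(_ isT).
  by rewrite ler_norml => /andP[]; lra.
Qed.

Hypothesis zfl_neq0 : forall t : R, 0 < t < tstar beta -> zfl beta t != 0.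

Lemma zfl_gt0 t : 0 < t < tstar beta -> 0 < zfl beta t.
Proof.
move=> t0; rewrite lt_neqAle eq_sym zfl_neq0//= leNgt; apply/negP => zt.
have /andP[t0' tl] := t0.
by have := tstar_le (ltW t0') zt; rewrite leNgt tl.
Qed.

Lemma zfl_min_gt0 a b : 0 < a -> b < tstar beta -> exists2 m, 0 < m &
  forall t, a <= t <= b -> m <= zfl beta t.
Proof.
move=> a0 bt; have [ab|ba] := leP a b; last first.
  exists 1 => // t /andP[at_ tb]; have := le_trans at_ tb; by rewrite leNgt ba.
have cont : {within `[a, b], continuous (zfl beta)}.
  apply: continuous_in_subspaceT => x; rewrite inE /= in_itv /= => /andP[ax xb].
  have x0 : 0 < x by exact: lt_le_trans ax.
  have x1 : x < 1 by exact: le_lt_trans xb (lt_trans bt tstar_lt1).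
  apply/cvgrPdist_le => eps eps0; have [rho rho0 h] := zfl_unif_continuous eps0.
  have r0 : 0 < Num.min rho (Num.min x (1 - x)).
    by rewrite !lt_min rho0 x0 subr_gt0.
  apply/nbhs_ballP; exists (Num.min rho (Num.min x (1 - x))) => // t.
  rewrite /ball /= !lt_min => /and3P[t1 t2 t3]; apply: h; last exact: ltW.
    by rewrite !ltW.
  by move: t2 t3; rewrite !ltr_norml => /andP[? ?] /andP[? ?]; apply/andP; split; lra.
have [c + cmin] := EVT_min ab cont.
rewrite in_itv /= => /andP[ac cb].
exists (zfl beta c).
  by apply: zfl_gt0; rewrite (lt_le_trans a0 ac) (le_lt_trans cb bt).
by move=> t tab; apply: cmin; rewrite in_itv.
Qed.

(** Three regimes: at least [m] on [[delta], [tstar - rho]], small in the window from there to [t1],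
    and at most [- m] at [t1] just after [tstar]. Continuity at scale [eta] fixes [rho], and [m] is
    the smaller of the two margins. *)
Lemma zfl_shape eta delta rho0 : 0 < eta -> 0 < delta -> 0 < rho0 ->
  exists rho t1 m, [/\ 0 < rho <= rho0, tstar beta < t1 < 1, 0 < m & zfl beta t1 <= - m] /\
   (forall t, 0 <= t -> tstar beta - rho < t <= t1 -> `|zfl beta t| <= eta) /\
   (forall t, delta <= t <= tstar beta - rho -> m <= zfl beta t).
Proof.
move=> eta0 delta0 rho00.
have [r r0 h] := zfl_unif_continuous eta0.
pose rho := Num.min r rho0.
have rhop : 0 < rho by rewrite lt_min r0.
have [t1 [ht1 t1u t11' zt1]] := tstar_adherent rhop.
have [m m0 hm] : exists2 m, 0 < m & forall t, delta <= t <= tstar beta - rho -> m <= zfl beta t.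
  by apply: zfl_min_gt0 => //; rewrite gtrBl.
exists rho, t1, (Num.min m (- zfl beta t1)); split; [split|split].
- by rewrite rhop ge_min lexx orbT.
- rewrite t11' andbT lt_neqAle ht1 andbT.
  by apply: contraTneq zt1 => <-; rewrite zfl_tstar ltxx.
- by rewrite lt_min m0 oppr_gt0.
- by rewrite lerNr ge_min lexx orbT.
- move=> t t0 /andP[tl tu].
  rewrite -[zfl beta t]subr0 -zfl_tstar; apply: h.
  + by rewrite t0 (le_trans tu)// ltW.
  + by rewrite tstar_ge0 ltW// tstar_lt1.
  + have rr : rho <= r by rewrite ge_min lexx.
    by rewrite ler_norml; lra.
- by move=> t /hm; apply: le_trans; rewrite ge_min lexx.
Qed.

End FluidLimit.

(** * Deterministic comparison of the walk with its limit *)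

Section Approximation.
Context {R : realType} (beta : nat -> R).
Hypothesis beta_ge0 : forall j : nat, (2 <= j)%N -> 0 <= beta j.

Lemma mesh_point (h t : R) (K : nat) : 0 < h -> (0 < K)%N -> 0 <= t <= K%:R * h ->
  exists2 l, (l < K)%N & l%:R * h <= t <= l.+1%:R * h.
Proof.
move=> h0 K0 /andP[t0 tK]; have th0 : 0 <= t / h by rewrite divr_ge0// ltW.
have /andP[h1 h2] := truncn_itv th0.
have {}h1 : (Num.truncn (t / h))%:R * h <= t by rewrite -ler_pdivlMr.
have {}h2 : t <= (Num.truncn (t / h)).+1%:R * h by rewrite -ler_pdivrMr// ltW.
have [lK|Kl] := ltnP (Num.truncn (t / h)) K; first by exists (Num.truncn (t / h)); rewrite ?h1.
(* Only the right end [t = K * h] is left; it goes to the last cell. *)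
exists K.-1; first by rewrite prednK.
rewrite prednK// tK andbT; apply: le_trans h1; rewrite ler_pM2r// ler_nat.
exact: leq_trans (leq_pred K) Kl.
Qed.

Section Deterministic.
Variable N : nat.
Hypothesis N_gt0 : (0 < N)%N.
Implicit Types c : config N.

Let N0 : 0 < N%:R :> R. Proof. by rewrite ltr0n. Qed.

Let time (t : R) : nat := Num.truncn (N%:R * t).

Let time_le t : 0 <= t -> (time t)%:R <= N%:R * t.
Proof. by move=> t0; rewrite truncn_le mulr_ge0// ltW. Qed.

Let time_gt t : N%:R * t < (time t)%:R + 1.
Proof. by rewrite natr1; exact: truncnS_gt. Qed.

Let le_time s t : s <= t -> (time s <= time t)%N.
Proof. by move=> st; apply: le_truncn; rewrite ler_pM2l. Qed.

(** At the two mesh times around [t] the errors are the deviation, the error in [cumrate] and the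
    oscillation of the exponential over one cell, hence [3 * eps], plus the patches. Monotonicity of
    [Zwalk c i + i] sandwiches time [t] between them. *)
Lemma walk_mesh_close c (K : nat) (h eps : R) (kappa : nat) (t : R) :
  (0 < K)%N -> 0 < h -> K%:R * h <= 1 -> 0 <= eps ->
  (forall l, (l <= K)%N -> `|deviation beta c (time (l%:R * h))| <= eps * N%:R) ->
  (forall l, (l <= K)%N -> `|expR (- betaD beta (l%:R * h))
      - expR (- cumrate beta N (time (l%:R * h)))| <= eps) ->
  (forall s t, 0 <= s <= 1 -> 0 <= t <= 1 -> `|s - t| <= h ->
     `|expR (- betaD beta s) - expR (- betaD beta t)| <= eps) ->
  0 <= t <= K%:R * h ->
  (forall j, (j <= time t)%N -> - kappa%:Z <= Zwalk c j) ->
  `|(Zwalk c (time t))%:~R - N%:R * zfl beta t| <= N%:R * (3 * eps + h) + kappa%:R + 4.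
Proof.
move=> K0 h0 Kh1 eps0 dev Q unif tK low.
have /andP[t0 tK'] := tK.
have t01 : 0 <= t <= 1 by rewrite t0 (le_trans tK').
have [l lK /andP[lt tl]] := mesh_point h0 K0 tK.
have grid i (p : R) : (i <= K)%N -> `|i%:R * h - t| <= h ->
    (npatch c (time (i%:R * h)))%:R <= p ->
    `|(Zwalk c (time (i%:R * h)))%:~R + (time (i%:R * h))%:R -
      N%:R * (1 - expR (- betaD beta t))| <= 3 * eps * N%:R + p.
  move=> iK it ip.
  have i01 : 0 <= i%:R * h <= 1.
    rewrite mulr_ge0 ?(ltW h0)//=; apply: le_trans Kh1.
    by rewrite ler_pM2r// ler_nat.
  have h1 := Zwalk_deviation beta_ge0 c (time (i%:R * h)).
  have h2 := dev _ iK.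
  have h3 : `|N%:R * (expR (- betaD beta (i%:R * h))
      - expR (- cumrate beta N (time (i%:R * h))))| <= N%:R * eps.
    by rewrite normrM ger0_norm ?(ltW N0)// ler_wpM2l ?(ltW N0)// Q.
  have h4 : `|N%:R * (expR (- betaD beta (i%:R * h)) - expR (- betaD beta t))| <= N%:R * eps.
    by rewrite normrM ger0_norm ?(ltW N0)// ler_wpM2l ?(ltW N0)// unif.
  set Z := _%:~R in h1 *; set g := (time (i%:R * h))%:R in h1 *.
  set q := expR (- cumrate _ _ _) in h1 h3; set b := expR (- betaD beta (i%:R * h)) in h3 h4.
  set e := expR (- betaD beta t) in h4 *.
  have -> : Z + g - N%:R * (1 - e) = (Z - (N%:R - g - N%:R * q)) + N%:R * (b - q)
     - N%:R * (b - e) by ring.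
  have -> : 3 * eps * N%:R + p = (eps * N%:R + p) + N%:R * eps + N%:R * eps by ring.
  apply: le_trans (ler_normB _ _) _; apply: lerD => //.
  apply: le_trans (ler_normD _ _) _; apply: lerD => //.
  by apply: le_trans h1 _; apply: lerD.
set g := time (l%:R * h); set g' := time (l.+1%:R * h); set n := time t.
have gn : (g <= n)%N by exact: le_time.
have ng : (n <= g')%N by exact: le_time.
have lh0 : 0 <= l%:R * h by rewrite mulr_ge0// ltW.
have hS : l.+1%:R * h = l%:R * h + h by rewrite -natr1 mulrDl mul1r.
have g'n : (g' - n)%N%:R <= N%:R * h + 1.
  rewrite natrB//; have := time_gt t; have := @time_le (l.+1%:R * h).
  rewrite hS addr_ge0 ?(ltW h0)// => /(_ isT); rewrite -hS -/g' -/n.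
  have : N%:R * (l%:R * h) <= N%:R * t by rewrite ler_pM2l.
  rewrite hS mulrDr; lra.
have pg : (npatch c g)%:R <= kappa%:R + 1 :> R.
  rewrite natr1 ler_nat; apply: npatch_le => j jg; apply: low.
  exact: leq_trans (ltnW jg) gn.
(* The right mesh time may lie after the last time at which the walk is controlled; the extra
   patches are at most one per step, about [N * h] in all. *)
have pg' : (npatch c g')%:R <= kappa%:R + (N%:R * h + 1) + 1.
  apply: (@le_trans _ _ (kappa + (g' - n)).+1%:R).
    by rewrite ler_nat; exact: npatch_le_extend.
  by rewrite -natr1 natrD lerD2r lerD2l.
have c1 := grid l _ (ltnW lK) _ pg.
have c2 := grid l.+1 _ lK _ pg'.
have {}c1 := c1 ltac:(by rewrite ler_norml; move: lt tl; rewrite hS; lra).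
have {}c2 := c2 ltac:(by rewrite ler_norml; move: lt tl; rewrite hS; lra).
have m1 : (Zwalk c g)%:~R + g%:R <= (Zwalk c n)%:~R + n%:R :> R.
  by rewrite !pmulrn -!intrD ler_int; exact: Zwalk_drift.
have m2 : (Zwalk c n)%:~R + n%:R <= (Zwalk c g')%:~R + g'%:R :> R.
  by rewrite !pmulrn -!intrD ler_int; exact: Zwalk_drift.
have n1 := time_le t0; have n2 := time_gt t; rewrite -/n in n1 n2.
rewrite -/g in c1; rewrite -/g' in c2.
rewrite /zfl; set e := expR (- betaD beta t) in c1 c2 *.
have Nh : 0 <= N%:R * h by rewrite mulr_ge0// ltW.
have Ne : 0 <= N%:R * eps by rewrite mulr_ge0// ltW.
have k0 : 0 <= kappa%:R :> R by [].
move: c1 c2; rewrite !ler_norml => /andP[c11 c12] /andP[c21 c22].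
have -> : N%:R * (1 - t - e) = N%:R * (1 - e) - N%:R * t by ring.
have -> : N%:R * (3 * eps + h) = 3 * eps * N%:R + N%:R * h by ring.
by apply/andP; split; lra.
Qed.

(** As long as the walk stays above [- kappa.+1] it follows [N * zfl] within [N * a]. So it can
    neither undershoot before [tstar - rho] nor avoid undershooting beyond [t1]; in between, the
    walk and its limit are both small on the scale [N]. *)
Lemma walk_excursion c (delta t1 m rho eta a : R) (kappa : nat) :
  0 < delta -> 0 < rho -> tstar beta < t1 < 1 -> 0 <= tstar beta -> zfl beta t1 <= - m ->
  (forall t, 0 <= t -> tstar beta - rho < t <= t1 -> `|zfl beta t| <= eta) ->
  (forall t, delta <= t <= tstar beta - rho -> m <= zfl beta t) ->
  a <= eta -> 2 * a < m -> kappa.+1%:R <= N%:R * a ->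
  (forall t, 0 <= t <= t1 -> (forall j, (j <= time t)%N -> - kappa.+1%:Z <= Zwalk c j) ->
     `|(Zwalk c (time t))%:~R - N%:R * zfl beta t| <= N%:R * a) ->
  (forall j, (j <= time delta)%N -> - kappa%:Z <= Zwalk c j) ->
  (forall t, 0 <= t <= 1 ->
     `|(Ztilde c (time delta) (time t))%:~R / N%:R - ztilde beta t| <= 3 * eta) /\
  (forall t, 0 <= t <= tstar beta - rho ->
     `|(Zwalk c (time t))%:~R / N%:R - zfl beta t| <= eta).
Proof.
move=> delta0 rho0 /andP[tt1 t11] ts0 zt1 near_ts far_ts aeta am ka close low.
have a0 : 0 <= a.
  by rewrite -(pmulr_rge0 _ N0); apply: le_trans ka.
have eta0 : 0 <= eta by exact: le_trans aeta.
have t10 : 0 <= t1 by rewrite (le_trans ts0) ?ltW.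
have lowS j := @opprz_leS kappa (Zwalk c j).
have kap (j : nat) : - kappa.+1%:Z <= Zwalk c j -> - (N%:R * a) <= (Zwalk c j)%:~R :> R.
  move=> hj; apply: (@le_trans _ _ (- kappa.+1%:R)); first by rewrite lerN2.
  by rewrite pmulrn -mulrNz ler_int.
(* At [t1] the walk would be at most [- N * m + N * a < - N * a], below its assumed floor. *)
have reach t : t1 < t -> ~ (forall j, (j <= time t)%N -> - kappa.+1%:Z <= Zwalk c j).
  move=> t1t lowt.
  have lowt1 j : (j <= time t1)%N -> - kappa.+1%:Z <= Zwalk c j.
    by move=> jt; apply: lowt; apply: leq_trans jt _; apply: le_time; exact: ltW.
  have := close t1 _ lowt1; rewrite t10 lexx => /(_ isT).
  have := kap _ (lowt1 _ (leqnn _)).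
  have : N%:R * zfl beta t1 <= - (N%:R * m) by rewrite -mulrN ler_pM2l.
  have : N%:R * (2 * a) < N%:R * m by rewrite ltr_pM2l.
  by rewrite ler_norml => ? ? ? /andP[]; lra.
have scale (x z b : R) : `|x - N%:R * z| <= N%:R * b -> `|x / N%:R - z| <= b.
  move=> hx; rewrite -(ler_pM2l N0) -{1}(ger0_norm (ltW N0)) -normrM mulrBr mulrCA.
  by rewrite divff ?gt_eqF// mulr1.
(* An undershoot at a time in [[delta], [tstar - rho]] would make the walk nonpositive where it is
   at least [N * (m - a) > 0]. *)
have first_time t T : 0 <= t -> (time delta < T <= time t)%N ->
    (forall j, (j <= T)%N -> - kappa.+1%:Z <= Zwalk c j) -> Zwalk c T <= 0 ->
    tstar beta - rho < t.
  move=> t0 /andP[dT Tt] lowT ZT; rewrite ltNge; apply/negP => tlow.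
  pose s : R := T%:R / N%:R.
  have sT : time s = T.
    by rewrite /time /s mulrCA divff ?gt_eqF// mulr1 natrK.
  have s0 : 0 <= s by rewrite divr_ge0// ltW.
  have st : s <= t.
    rewrite ler_pdivrMr// mulrC; apply: le_trans (time_le t0).
    by rewrite ler_nat.
  have ds : delta <= s.
    rewrite ler_pdivlMr// mulrC; apply: le_trans (ltW (time_gt delta)) _.
    by rewrite natr1 ler_nat.
  have st1 : s <= t1 by lra.
  have := close s _; rewrite sT s0 st1 => /(_ isT lowT).
  have zs : m <= zfl beta s by apply: far_ts; rewrite ds (le_trans st).
  have : N%:R * m <= N%:R * zfl beta s by rewrite ler_pM2l.
  have : N%:R * (2 * a) < N%:R * m by rewrite ltr_pM2l.
  have : (Zwalk c T)%:~R <= 0 :> R by rewrite lerz0.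
  have : 0 <= N%:R * a by rewrite mulr_ge0// ltW.
  by rewrite ler_norml => ? ? ? ? /andP[]; lra.
split=> t /andP[t0 tu].
  have [[lown ->]|[T [dTt lowT ZT ->]]] := Ztilde_dichotomy (time t) low.
    have tt1' : t <= t1.
      rewrite leNgt; apply/negP => t1t; apply: (reach _ t1t) => j jt.
      by apply: lowS; exact: lown.
    have hc : `|(Zwalk c (time t))%:~R / N%:R - zfl beta t| <= a.
      by apply: scale; apply: close; [rewrite t0|move=> j jt; apply: lowS; exact: lown].
    rewrite /ztilde; have [tts|tst] := leP t (tstar beta); first by lra.
    (* Past [tstar] but not yet frozen: the walk follows [zfl t] while the target is [zfl] at
       [tstar]; both values are within [eta] of 0, whence the factor 3. *)
    have := near_ts t t0; rewrite tt1' andbT => /(_ ltac:(lra)).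
    have := near_ts _ ts0; rewrite (ltW tt1) andbT gtrBl => /(_ rho0).
    by move=> zts zt; exact: dist_small hc zt zts aeta.
  have tl := first_time _ _ t0 dTt lowT ZT.
  have m0 : 0 <= Num.min t (tstar beta) by rewrite le_min t0.
  have := near_ts _ m0; rewrite lt_min tl gtrBl rho0 ge_min (ltW tt1) orbT => /(_ isT).
  have ZT1 : `|(Zwalk c T)%:~R / N%:R| <= a.
    rewrite -[X in `|X|]subr0; apply: scale; rewrite mulr0 subr0 ler0_norm ?lerz0//.
    by rewrite lerNl kap// lowT.
  rewrite -/(ztilde beta t); move: ZT1; rewrite !ler_norml => /andP[? ?] /andP[? ?].
  by apply/andP; split; lra.
have [[lown _]|[T [dTt lowT ZT _]]] := Ztilde_dichotomy (time t) low; last first.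
  by have := first_time _ _ t0 dTt lowT ZT; rewrite ltNge tu.
apply: le_trans aeta; apply: scale; apply: close.
  by rewrite t0; lra.
by move=> j jt; apply: lowS; exact: lown.
Qed.

(** Up to time [N ^ alpha * r ^ 2 <= kappa] the walk has lost at most one per step; from then until
    [N * delta] it is positive, since otherwise [SNR] would be at most [N * delta]. *)
Lemma SNR_lower c k (r delta : R) (kappa : nat) :
  N%:R `^ alpha k * r ^+ 2 <= kappa%:R -> 0 < delta ->
  ~ (SNR k c r <= (N%:R * delta)%:E)%E ->
  forall j, (j <= time delta)%N -> - kappa%:Z <= Zwalk c j.
Proof.
move=> hk d0 hS j jd; have [jk|kj] := ltP (j%:R : R) (N%:R `^ alpha k * r ^+ 2).
  have : (j <= kappa)%N by rewrite -(ler_nat R) (le_trans (ltW jk)).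
  have := Zwalk_ge c j; lia.
suff : 0 < Zwalk c j by lia.
rewrite ltNge; apply/negP => Zj; apply: hS.
apply: (@le_trans _ _ (j%:R)%:E).
  by apply: ereal_inf_lbound; exists j.
rewrite lee_fin; apply: le_trans (time_le (ltW d0)); by rewrite ler_nat.
Qed.

End Deterministic.
End Approximation.

(** * Law of large numbers *)

Section LawOfLargeNumbers.
Context {R : realType} (beta : nat -> R).
Hypothesis beta_ge0 : forall j : nat, (2 <= j)%N -> 0 <= beta j.

Lemma near_forall_le (P : nat -> nat -> Prop) K :
  (forall l, (l <= K)%N -> \forall n \near \oo, P l n) ->
  \forall n \near \oo, forall l, (l <= K)%N -> P l n.
Proof.
elim: K => [|K IH] h.
  apply: filterS (h 0%N (leqnn _)) => n Pn l.
  by rewrite leqn0 => /eqP ->.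
have h1 := IH (fun l lK => h l (leqW lK)); have h2 := h K.+1 (leqnn _).
apply: filterS2 h1 h2 => n h1 h2 l; rewrite leq_eqVlt => /predU1P[->//|].
by rewrite ltnS; exact: h1.
Qed.

Lemma cumrate_ge0 N i : 0 <= cumrate beta N i.
Proof.
by apply: sumr_ge0 => j _; rewrite mulr_ge0// divr_ge0// mulr_ge0// beta_ge0.
Qed.

Lemma alpha_lt1 k : (3 <= k)%N -> alpha k < 1 :> R.
Proof.
move=> k3; have : 3 <= k%:R :> R by rewrite (ler_nat R 3).
by move=> ?; rewrite /alpha ltr_pdivrMr; lra.
Qed.

Lemma SNR_supp k N (c : config N) (r : R) : SNR k (unitcfg (supp c)) r = SNR k c r.
Proof.
have ZE : Zwalk (unitcfg (supp c)) = Zwalk c by apply/funext => j; exact: Zwalk_supp.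
by rewrite /SNR ZE.
Qed.

Lemma Ztilde_supp N (c : config N) n0 i : Ztilde (unitcfg (supp c)) n0 i = Ztilde c n0 i.
Proof.
have ZE : Zwalk (unitcfg (supp c)) = Zwalk c by apply/funext => j; exact: Zwalk_supp.
by rewrite /Ztilde /Zmin ZE.
Qed.

Let absent N (A : {set 'I_N}) : R := expR (- hmean beta A).

Lemma absent01 N (A : {set 'I_N}) : 0 <= absent A <= 1.
Proof. by rewrite /absent expR_ge0 -expR0 ler_expR oppr_le0 hmean_ge0. Qed.

Lemma deviation_tail N i (eps : R) : (0 < N)%N -> 0 < eps ->
  bexp (@absent N) (fun b => (eps * N%:R < `|deviation beta (unitcfg b) i|)%R%:R) <=
  (eps ^+ 2 * N%:R)^-1.
Proof.
move=> N0 eps0; have nN : 0 < N%:R :> R by rewrite ltr0n.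
have en : 0 < eps * N%:R by rewrite mulr_gt0.
apply: (@le_trans _ _ (bexp (@absent N)
   (fun b => ((eps * N%:R) ^+ 2)^-1 * deviation beta (unitcfg b) i ^+ 2))).
  apply: bexp_le => [A|b]; first exact: absent01.
  case: ltP => [h|_]; last by rewrite mulr_ge0 ?invr_ge0 ?sqr_ge0.
  rewrite mulrC ler_pdivlMr ?exprn_gt0// mul1r -[leRHS]real_normK ?num_real//.
  by rewrite ler_pXn2r ?nnegrE ?normr_ge0 ?(ltW en) ?(ltW h).
rewrite bexpZ; apply: (@le_trans _ _ (((eps * N%:R) ^+ 2)^-1 * N%:R)).
  by rewrite ler_wpM2l ?invr_ge0 ?sqr_ge0// deviation_sqr_le.
by rewrite exprMn [N%:R ^+ 2]expr2 mulrA invfM -mulrA mulVf ?mulr1// gt_eqF.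
Qed.

(** Union bound: [Bad] is contained in the event [SNR <= N * delta] together with [K + 1] large
    deviations. First fix [r] so that the limiting probability of the former is below [eta / 2]; the
    latter then total at most [(K + 1) / (eps ^ 2 * N)], which vanishes as [N] grows. *)
Lemma hprob_cvg0 (k : nat) (delta : R) (Bad : forall N, set (config N)) :
  (forall N (c : config N), Bad N c <-> Bad N (unitcfg (supp c))) ->
  (exists L : R -> \bar R,
     (forall r : R,
        (fun N : nat =>
           hprob beta [set c : config N | (SNR k c r <= (N%:R * delta)%:E)%E])
          @ \oo --> L r) /\
     (L r @[r --> +oo] --> 0%E)) ->
  (forall r : R, exists (eps : R) (K : nat) (tm : nat -> nat -> nat),
     0 < eps /\ \forall N \near \oo, forall c : config N,
     ~ (SNR k c r <= (N%:R * delta)%:E)%E ->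
     (forall l, (l <= K)%N -> `|deviation beta c (tm N l)| <= eps * N%:R) -> ~ Bad N c) ->
  (fun N => hprob beta (Bad N)) @ \oo --> 0%E.
Proof.
move=> Bsupp [L [SL L0]] good.
pose x N := bexp (@absent N) (fun b => `[< Bad N (unitcfg b) >]%:R).
have xE : (fun N => hprob beta (Bad N)) = (fun N => (x N)%:E).
  by apply/funext => N; apply: hprobE => // c; exact: Bsupp.
rewrite xE; suff : x @ \oo --> (0 : R) by move=> h; apply: cvg_EFin => //; exact: nearW.
apply/cvgrPdist_le => eta eta0.
have e2 : 0 < eta / 2 by rewrite divr_gt0.
have e20 : (0%E < (eta / 2)%:E)%E by rewrite lte_fin.
have [r Lr] : exists r, (L r < (eta / 2)%:E)%E.
  have : \forall r \near +oo%R, (L r < (eta / 2)%:E)%E.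
    exact: (L0 _ (open_ereal_lt' e20)).
  move=> [M [_ hM]]; exists (M + 1); apply: hM; by rewrite ltrDl.
have Snear : \forall N \near \oo,
    (hprob beta [set c : config N | (SNR k c r <= (N%:R * delta)%:E)%E] < (eta / 2)%:E)%E.
  exact: (SL r _ (open_ereal_lt' Lr)).
have [eps [K [tm [eps0 bad]]]] := good r.
near=> N.
have N0 : (0 < N)%N by near: N; exact: nbhs_infty_gt.
have nN : 0 < N%:R :> R by rewrite ltr0n.
have x0 : 0 <= x N.
  by apply: sumr_ge0 => b _; rewrite mulr_ge0// bwt_ge0// => A; exact: absent01.
rewrite sub0r normrN ger0_norm//.
pose y := bexp (@absent N) (fun b => `[< (SNR k (unitcfg b) r <= (N%:R * delta)%:E)%E >]%:R).
have y_lt : y < eta / 2.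
  have : (hprob beta [set c : config N | (SNR k c r <= (N%:R * delta)%:E)%E] < (eta / 2)%:E)%E.
    by near: N.
  rewrite (hprobE beta_ge0) ?lte_fin; last by move=> c; rewrite /= SNR_supp.
  exact.
have badN : forall c : config N,
     ~ (SNR k c r <= (N%:R * delta)%:E)%E ->
     (forall l, (l <= K)%N -> `|deviation beta c (tm N l)| <= eps * N%:R) -> ~ Bad N c.
  by near: N.
have xy : x N <= y + \sum_(l < K.+1) bexp (@absent N)
    (fun b => (eps * N%:R < `|deviation beta (unitcfg b) (tm N l)|)%R%:R).
  rewrite -bexp_sum -bexpD; apply: bexp_le => [A|b]; first exact: absent01.
  case: asboolP => [Bb|_]; last by rewrite addr_ge0// sumr_ge0.
  case: asboolP => [_|nS]; first by rewrite lerDl sumr_ge0.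
  rewrite add0r; case: (pselect (exists l : 'I_K.+1,
    eps * N%:R < `|deviation beta (unitcfg b) (tm N l)|)).
    by move=> [l hl]; rewrite (bigD1 l)//= hl lerDl sumr_ge0.
  move=> nl; exfalso; apply: badN Bb => // l lK; rewrite leNgt; apply/negP => hl.
  by apply: nl; exists (Ordinal (lK : (l < K.+1)%N)).
apply: le_trans xy _; rewrite (splitr eta) lerD// ?(ltW y_lt)//.
apply: (@le_trans _ _ (\sum_(l < K.+1) (eps ^+ 2 * N%:R)^-1)).
  by apply: ler_sum => l _; exact: deviation_tail.
rewrite sumr_const card_ord -[leLHS]mulr_natl ler_pdivrMr ?mulr_gt0 ?exprn_gt0//.
rewrite mulrA -ler_pdivrMl ?mulr_gt0 ?exprn_gt0//.
by near: N; exact: nbhs_infty_ger.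
Unshelve. all: by end_near. Qed.

Hypothesis beta_cvg : cvg ((fun n : nat => \sum_(2 <= j < n) j%:R * beta j) @ \oo).
Hypothesis zfl_neq0 : forall t : R, 0 < t < tstar beta -> zfl beta t != 0.

(** Fixes all constants in order: the shape of [zfl], the accuracy [a], the mesh, and finally [N]
    large enough for [N ^ alpha * r ^ 2] to be negligible against [N]. *)
Lemma good_event (k : nat) (delta r eps0 rho0 : R) :
  (3 <= k)%N -> 0 < delta -> 0 < eps0 -> 0 < rho0 ->
  exists (eps : R) (K : nat) (tm : nat -> nat -> nat),
  0 < eps /\ \forall N \near \oo, forall c : config N,
    ~ (SNR k c r <= (N%:R * delta)%:E)%E ->
    (forall l, (l <= K)%N -> `|deviation beta c (tm N l)| <= eps * N%:R) ->
    (forall t, 0 <= t <= 1 ->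
      `|(Ztilde c (Num.truncn (N%:R * delta)) (Num.truncn (N%:R * t)))%:~R / N%:R
        - ztilde beta t| <= eps0) /\
    (forall t, 0 <= t <= tstar beta - rho0 ->
      `|(Zwalk c (Num.truncn (N%:R * t)))%:~R / N%:R - zfl beta t| <= eps0).
Proof.
move=> k3 delta0 eps00 rho00.
have eta0 : 0 < eps0 / 3 by rewrite divr_gt0.
have [rho [t1 [m [[/andP[rhop rhole] t1b m0 zt1] [near_ts far_ts]]]]] :=
  zfl_shape beta_ge0 beta_cvg zfl_neq0 eta0 delta0 rho00.
have ts0 := tstar_ge0 beta.
(* The bound [m / 3] ensures [2 * a < m], and [eps0 / 3] is the size of the window in
   [zfl_shape]. *)
pose a := Num.min (m / 3) (eps0 / 3).
have a0 : 0 < a by rewrite lt_min !divr_gt0.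
have e1 : 0 < a / 12 by rewrite divr_gt0.
have [rho1 rho10 unif] := expRN_betaD_unif_continuous beta_ge0 beta_cvg e1.
have /andP[tt1 t11] := t1b.
have t10 : 0 < t1 by exact: le_lt_trans tt1.
pose d := Num.min rho1 (a / 4).
have d0 : 0 < d by rewrite lt_min rho10 divr_gt0.
(* The mesh divides [0, [t1]] exactly into [K] cells of width at most [d]. *)
pose K := (Num.truncn (t1 / d)).+1.
have K0 : 0 < K%:R :> R by rewrite ltr0n.
pose h := t1 / K%:R.
have h0 : 0 < h by rewrite divr_gt0.
have Kh : K%:R * h = t1 by rewrite mulrC divfK// gt_eqF.
have hd : h <= d.
  rewrite ler_pdivrMr// mulrC -ler_pdivrMr//; exact/ltW/truncnS_gt.
exists (a / 12), K, (fun N l => Num.truncn (N%:R * (l%:R * h))); split => //.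
have lh l : (l <= K)%N -> 0 <= l%:R * h < 1.
  move=> lK; rewrite mulr_ge0 ?(ltW h0)//=; apply: le_lt_trans t11.
  by rewrite -Kh ler_pM2r// ler_nat.
have r20 : 0 < r ^+ 2 + 1 by rewrite ltr_wpDl// sqr_ge0.
have e4 : 0 < a / 4 / (r ^+ 2 + 1) by rewrite !divr_gt0.
have sub := powR_sublinear (alpha_lt1 k3) e4.
have Qnear : \forall N \near \oo, forall l, (l <= K)%N ->
    `|expR (- betaD beta (l%:R * h))
      - expR (- cumrate beta N (Num.truncn (N%:R * (l%:R * h))))| <= a / 12.
  apply: near_forall_le => l lK.
  have /cvgrPdist_le /(_ _ e1) := cumrate_cvg beta_ge0 beta_cvg (lh l lK).
  apply: filterS => N; apply: le_trans; apply: dist_expRN_le; last exact: cumrate_ge0.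
  by apply: betaD_ge0 => //; have /andP[? ?] := lh l lK; apply/andP; split => //; exact: ltW.
near=> N => c nS dev.
have N0 : (0 < N)%N by near: N; exact: nbhs_infty_gt.
have nN : 0 < N%:R :> R by rewrite ltr0n.
pose p : R := N%:R `^ alpha k * r ^+ 2.
have p0 : 0 <= p by rewrite mulr_ge0 ?powR_ge0 ?sqr_ge0.
have pN : p <= N%:R * (a / 4).
  have : (N%:R : R) `^ alpha k <= a / 4 / (r ^+ 2 + 1) * N%:R by near: N.
  move=> hN; apply: (@le_trans _ _ (a / 4 / (r ^+ 2 + 1) * N%:R * (r ^+ 2 + 1))).
    by apply: ler_pM => //; rewrite ?powR_ge0 ?sqr_ge0// lerDl.
  by rewrite mulrAC divfK ?gt_eqF// mulrC.
have N6 : 6 <= N%:R * (a / 4).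
  rewrite -ler_pdivrMr ?divr_gt0//; by near: N; exact: nbhs_infty_ger.
pose kappa := (Num.truncn p).+1.
have kp : p <= kappa%:R by exact/ltW/truncnS_gt.
have pk : kappa%:R <= p + 1 by rewrite /kappa -natr1 lerD2r truncn_le.
have kS : kappa.+1%:R = kappa%:R + 1 :> R by rewrite natr1.
have [ha1 ha2] : a <= m / 3 /\ a <= eps0 / 3.
  by split; rewrite ge_min lexx ?orbT.
have hh : N%:R * h <= N%:R * (a / 4).
  by rewrite ler_pM2l// (le_trans hd)// ge_min lexx orbT.
have low := SNR_lower N0 kp delta0 nS.
have close t : 0 <= t <= t1 ->
    (forall j, (j <= Num.truncn (N%:R * t))%N -> - kappa.+1%:Z <= Zwalk c j) ->
    `|(Zwalk c (Num.truncn (N%:R * t)))%:~R - N%:R * zfl beta t| <= N%:R * a.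
  move=> tt lowt; rewrite -Kh in tt.
  apply: le_trans (walk_mesh_close beta_ge0 N0 _ h0 _ (ltW e1) dev _ _ tt lowt) _ => //.
  - by rewrite Kh ltW.
  - by near: N.
  - move=> s u s01 u01 su; apply: unif => //; apply: le_trans su _.
    by rewrite (le_trans hd)// ge_min lexx.
  (* Each quarter of [N * a] pays for one error: the three terms [a / 12], the mesh width, [p], and
     the constant 6, which is 4 plus the two units by which [kappa.+1] may exceed [p]. *)
  - rewrite kS; move: hh pN N6 pk; lra.
have [] := walk_excursion N0 delta0 rhop t1b ts0 zt1 near_ts far_ts ha2 _ _ close low.
- lra.
- rewrite kS; move: pN N6 pk; have : 0 < N%:R * a by rewrite mulr_gt0. lra.
move=> h1 h2; split => t tt.
  by apply: le_trans (h1 t tt) _; lra.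
apply: le_trans (h2 t _) _; last by lra.
by move: tt => /andP[-> tt] /=; lra.
Unshelve. all: by end_near. Qed.

End LawOfLargeNumbers.

(** * The limit theorem for the modified walk and its consequence before [tstar] *)

Unset Implicit Arguments.
Set Strict Implicit.
Set Printing Implicit Defensive.

Theorem theorem5p3 (R : realType) (k : nat) (beta : nat -> R) (delta : R) :
  (3 <= k)%N ->
  (forall j : nat, (2 <= j)%N -> 0 <= beta j) ->
  cvg ((fun n : nat => \sum_(2 <= j < n) j%:R * beta j) @ \oo) ->
  (forall j : nat, (2 <= j)%N -> (j <= k.-1)%N -> beta j = 1 / (j%:R * (j%:R - 1))) ->
  1 / (k%:R * (k%:R - 1)) < beta k ->
  (forall t : R, 0 < t < tstar beta -> zfl beta t != 0) ->
  0 < delta ->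
  (exists L : R -> \bar R,
     (forall r : R,
        (fun N : nat =>
           hprob beta [set c : config N | (SNR k c r <= (N%:R * delta)%:E)%E])
          @ \oo --> L r) /\
     (L r @[r --> +oo] --> 0%E)) ->
  (forall eps : R, 0 < eps ->
     (fun N : nat =>
        hprob beta [set c : config N | exists t : R, 0 <= t <= 1 /\
           eps < `| (Ztilde c (Num.truncn (N%:R * delta)) (Num.truncn (N%:R * t)))%:~R
                     / N%:R - ztilde beta t |])
       @ \oo --> 0%E)
  /\
  (forall sigma : R, 0 < sigma < tstar beta ->
   forall eps : R, 0 < eps ->
     (fun N : nat =>
        hprob beta [set c : config N | exists t : R, 0 <= t <= sigma /\
           eps < `| (Zwalk c (Num.truncn (N%:R * t)))%:~R / N%:R - zfl beta t |])
       @ \oo --> 0%E).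
Proof.
move=> k3 beta_ge0 beta_cvg _ _ zfl_neq0 delta0 SNR0; split.
  move=> eps eps0; apply: (hprob_cvg0 beta_ge0 _ SNR0).
    by move=> N c /=; split=> -[t ht]; exists t; move: ht; rewrite Ztilde_supp.
  move=> r; have e2 : 0 < eps by [].
  have [e [K [tm [e0 good]]]] := good_event beta_ge0 beta_cvg zfl_neq0 r k3 delta0 e2 ltr01.
  exists e, K, tm; split => //; apply: filterS good => N good c nS dev [t [t01]].
  by have [/(_ t t01) h _] := good c nS dev; rewrite ltNge h.
move=> sigma /andP[_ st] eps eps0; apply: (hprob_cvg0 beta_ge0 _ SNR0).
  by move=> N c /=; split=> -[t ht]; exists t; move: ht; rewrite Zwalk_supp.
(* With this window width, the interval [0, [tstar - rho0]] on which the original walk is controlled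
   is exactly [0, [sigma]]. *)
move=> r; have rho0 : 0 < tstar beta - sigma by rewrite subr_gt0.
have [e [K [tm [e0 good]]]] := good_event beta_ge0 beta_cvg zfl_neq0 r k3 delta0 eps0 rho0.
exists e, K, tm; split => //; apply: filterS good => N good c nS dev [t [ts]].
have [_ /(_ t)] := good c nS dev; rewrite opprB addrC subrK => /(_ ts) h.
by rewrite ltNge h.
Qed.
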